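(* Let $f : S^{n} \to S^{n}$ be a $C^{1}$ diffeomorphism. Then there exist bi-Lipschitz paths $A_{t}, p^{1}_{t}, p^{2}_{t} : S^{n} \to S^{n}$, for $t \in [0,1]$, such that $A_{0}$, $p^{1}_{0}$ and $p^{2}_{0}$ are all the identity, and $A_{1} \circ p^{2}_{1} \circ p^{1}_{1} = f$.
   Context: $S^{n} = \mathbb{R}^{n} \cup \{\infty\}$ is the sphere of dimension $n$, equipped with the spherical metric $\chi$ given by $\chi(x,y) = \frac{|x-y|}{\sqrt{1+|x|^{2}}\sqrt{1+|y|^{2}}}$ for $x,y \in S^{n} \setminus \{\infty\}$ and $\chi(x,\infty) = \frac{1}{\sqrt{1+|x|^{2}}}$ for $x \in \mathbb{R}^{n}$. Bi-Lipschitz paths on $S^n$ are taken with respect to $\chi$. A homeomorphism $f: X \to Y$ of metric spaces is $L$-bi-Lipschitz ($L \geq 1$) if $d_X(x,y)/L \leq d_Y(f(x),f(y)) \leq L\, d_X(x,y)$ for all $x,y \in X$, and bi-Lipschitz if it is $L$-bi-Lipschitz for some $L \geq 1$. $LIP(X)$ denotes the bi-Lipschitz homeomorphisms of $X$ onto itself; $LIP(S^{n})$ denotes the orientation preserving bi-Lipschitz homeomorphisms of $S^{n}$. Bi-Lipschitz path: for a metric space $(X,d_X)$, a path $h:[0,1] \to LIP(X)$, $t \mapsto h_t$, is called a bi-Lipschitz path if for every $\epsilon > 0$ there exists $\delta > 0$ such that if $s,t \in [0,1]$ with $|s-t| < \delta$, the following two conditions hold: (i) $d_X(h_s \circ h_t^{-1}(x),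 x) < \epsilon$ for all $x \in X$; (ii) $h_s \circ h_t^{-1}$ is $(1+\epsilon)$-bi-Lipschitz with respect to $d_X$.
   Formalization: The diffeomorphism f is assumed orientation preserving (the claim fails for a reflection, since bi-Lipschitz paths from the identity end at maps of degree +1), and n is at least 1. *)

(* Defs.v *)
From HB Require Import structures.
From mathcomp Require Import all_boot all_order all_algebra.
From mathcomp Require Import all_classical all_reals all_analysis.
From mathcomp Require Import ring lra.
Set Implicit Arguments.
Unset Strict Implicit.
Unset Printing Implicit Defensive.
Import Order.TTheory GRing.Theory Num.Theory.
Import numFieldNormedType.Exports.
Local Open Scope classical_set_scope.
Local Open Scope ring_scope.

(* The library norm `|x| on 'rV[R]_n is the sup norm. *)
Definition enorm (R : realType) (n : nat) (x : 'rV[R]_n) : R :=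
  Num.sqrt (\sum_(i < n) x 0 i ^+ 2).

(* S^n = R^n ∪ {∞}: [None] is ∞ and [Some x] is the point x of R^n. *)
Definition sphere (R : realType) (n : nat) : Type := option 'rV[R]_n.

Definition chordal (R : realType) (n : nat) (p q : sphere R n) : R :=
  match p, q with
  | Some x, Some y =>
      enorm (x - y) / (Num.sqrt (1 + enorm x ^+ 2) * Num.sqrt (1 + enorm y ^+ 2))
  | Some x, None => 1 / Num.sqrt (1 + enorm x ^+ 2)
  | None, Some y => 1 / Num.sqrt (1 + enorm y ^+ 2)
  | None, None => 0
  end.

Section euclidean.
Context {R : realType} {n : nat}.
Implicit Types x y z : 'rV[R]_n.

Definition dotp x y : R := \sum_(i < n) x 0 i * y 0 i.

Lemma enorm_ge0 x : 0 <= enorm x.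
Proof. exact: sqrtr_ge0. Qed.

Lemma sqr_enorm x : enorm x ^+ 2 = dotp x x.
Proof.
rewrite /enorm sqr_sqrtr; last by apply: sumr_ge0 => i _; exact: sqr_ge0.
by apply: eq_bigr => i _; rewrite expr2.
Qed.

Lemma enorm0_eq0 x : enorm x = 0 -> x = 0.
Proof.
move=> x0; have := sqr_enorm x; rewrite x0 expr0n /= => /esym/eqP.
rewrite psumr_eq0; last by move=> i _; rewrite -expr2 sqr_ge0.
move=> /allP h; apply/rowP => i; rewrite mxE.
by have := h i (mem_index_enum _); rewrite mulf_eq0 orbb => /eqP.
Qed.

Lemma dotpC x y : dotp x y = dotp y x.
Proof. by apply: eq_bigr => i _; rewrite mulrC. Qed.

Lemma dotpDl x y z : dotp (x + y) z = dotp x z + dotp y z.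
Proof. by rewrite -big_split; apply: eq_bigr => i _; rewrite mxE mulrDl. Qed.

Lemma dotpZl a x y : dotp (a *: x) y = a * dotp x y.
Proof. by rewrite mulr_sumr; apply: eq_bigr => i _; rewrite mxE mulrA. Qed.

Lemma dotpNl x y : dotp (- x) y = - dotp x y.
Proof. by rewrite -scaleN1r dotpZl mulN1r. Qed.

Lemma sqr_enormB x y :
  enorm (x - y) ^+ 2 = enorm x ^+ 2 + enorm y ^+ 2 - 2 * dotp x y.
Proof.
rewrite !sqr_enorm !(dotpDl, dotpNl) ![dotp _ (x - y)]dotpC !(dotpDl, dotpNl).
rewrite (dotpC y x); ring.
Qed.

Lemma enormBC x y : enorm (x - y) = enorm (y - x).
Proof.
apply/eqP; rewrite -(@eqrXn2 _ 2) ?enorm_ge0// !sqr_enormB (dotpC y x).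
by apply/eqP; ring.
Qed.

Lemma dotp_le x y : dotp x y <= enorm x * enorm y.
Proof.
have [/enorm0_eq0 ->|x0] := eqVneq (enorm x) 0.
  by rewrite -(scale0r 0) dotpZl mul0r mulr_ge0// enorm_ge0.
have [/enorm0_eq0 ->|y0] := eqVneq (enorm y) 0.
  by rewrite dotpC -(scale0r 0) dotpZl mul0r mulr_ge0// enorm_ge0.
have xy0 : 0 < enorm x * enorm y.
  by rewrite mulr_gt0// lt0r ?x0 ?y0 enorm_ge0.
have := sqr_ge0 (enorm (enorm y *: x - enorm x *: y)).
rewrite sqr_enormB !sqr_enorm !dotpZl ![dotp _ (_ *: _)]dotpC !dotpZl.
rewrite -!sqr_enorm (dotpC y x) => h.
rewrite -(ler_pM2l xy0); nra.
Qed.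

Lemma enormD x y : enorm (x + y) <= enorm x + enorm y.
Proof.
have hxy := dotp_le x y.
rewrite -(@ler_pXn2r _ 2) ?nnegrE ?addr_ge0 ?enorm_ge0//.
have := sqr_enormB x (- y); rewrite opprK => ->.
rewrite dotpC dotpNl dotpC.
have -> : enorm (- y) = enorm y by rewrite -[in RHS](subr0 y) enormBC sub0r.
by rewrite sqrrD; nra.
Qed.

End euclidean.

Section chordal_metric.
Context {R : realType} {n : nat}.
Implicit Types p q r : sphere R n.

(* Stereographic projection onto the sphere of diameter 1 in R^(n+1) = R^n × R,
   under which [chordal] is the Euclidean distance. *)
Let stereo p : 'rV[R]_(n + 1) :=
  if p is Some x then
    row_mx ((1 + enorm x ^+ 2)^-1 *: x)
           (const_mx (enorm x ^+ 2 / (1 + enorm x ^+ 2)))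
  else row_mx 0 (const_mx 1).

Let dotp_row (x y : 'rV[R]_n) (a b : R) :
  dotp (row_mx x (const_mx a)) (row_mx y (const_mx b) : 'rV_(n + 1))
    = dotp x y + a * b.
Proof.
rewrite /dotp big_split_ord /= big_ord1 !row_mxEr !mxE; congr (_ + _).
by apply: eq_bigr => i _; rewrite !row_mxEl.
Qed.

Let chordal_ge0 p q : 0 <= chordal p q.
Proof.
by case: p q => [x|] [y|] //=; rewrite divr_ge0 ?mulr_ge0 ?sqrtr_ge0.
Qed.

Let chordalE p q : chordal p q = enorm (stereo p - stereo q).
Proof.
apply/eqP; rewrite -(@eqrXn2 _ 2) ?enorm_ge0 ?chordal_ge0//; apply/eqP.
have pos (x : 'rV[R]_n) : 0 < 1 + enorm x ^+ 2.
  by rewrite ltr_pwDl ?ltr01 ?sqr_ge0.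
have sq (x : 'rV[R]_n) : Num.sqrt (1 + enorm x ^+ 2) ^+ 2 = 1 + enorm x ^+ 2.
  by rewrite sqr_sqrtr// ltW.
have e0 : enorm (0 : 'rV[R]_n) ^+ 2 = 0 by rewrite sqr_enorm -(scale0r 0) dotpZl mul0r.
have d0 (x : 'rV[R]_n) : dotp 0 x = 0 by rewrite -(scale0r x) dotpZl mul0r.
case: p q => [x|] [y|];
  rewrite sqr_enormB !sqr_enorm /stereo !dotp_row ?dotpZl
    ?[dotp _ (_ *: _)]dotpC ?dotpZl ?d0 ?[dotp _ 0]dotpC ?d0 -?sqr_enorm /chordal
    ?expr_div_n ?exprMn ?sq ?sqr_enormB ?(dotpC y x).
- move: (enorm x ^+ 2) (enorm y ^+ 2) (pos x) (pos y) => a b a0 b0.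
  by field; rewrite !lt0r_neq0.
- by move: (enorm x ^+ 2) (pos x) => a a0; field; rewrite lt0r_neq0.
- by move: (enorm y ^+ 2) (pos y) => a a0; field; rewrite lt0r_neq0.
- by rewrite expr0n /=; ring.
Qed.

Let chordalxx p : chordal p p = 0.
Proof. by rewrite chordalE subrr /enorm big1 ?sqrtr0// => i _; rewrite mxE expr0n. Qed.

Let chordal_positivity p q : chordal p q = 0 -> p = q.
Proof.
have pos (x : 'rV[R]_n) : Num.sqrt (1 + enorm x ^+ 2) != 0.
  by rewrite lt0r_neq0// sqrtr_gt0 ltr_pwDl ?ltr01 ?sqr_ge0.
case: p q => [x|] [y|] //= /eqP;
  rewrite mulf_eq0 invr_eq0 ?mulf_eq0 ?(negbTE (pos _)) ?orbF ?oner_eq0//.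
by move=> /eqP/enorm0_eq0/eqP; rewrite subr_eq0 => /eqP ->.
Qed.

Let chordal_sym p q : chordal p q = chordal q p.
Proof. by rewrite !chordalE enormBC. Qed.

Let chordal_triangle q p r : chordal p r <= chordal p q + chordal q r.
Proof.
rewrite !chordalE -(subrKA (stereo q) (stereo p)); exact: enormD.
Qed.

HB.instance Definition _ := Choice.on (sphere R n).
HB.instance Definition _ := isMetric.Build R (sphere R n)
  chordalxx chordal_positivity chordal_sym chordal_triangle.

Lemma mdist_chordal p q : mdist p q = chordal p q.
Proof. by []. Qed.

End chordal_metric.

Definition bilipschitz (R : realType) (X Y : metricType R) (L : R) (f : X -> Y) :=
  forall x y : X,
    mdist x y / L <= mdist (f x) (f y) /\ mdist (f x) (f y) <= L * mdist x y.

(* The inequalities make a bi-Lipschitz bijection a homeomorphism, see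
   [LIP_continuous] and [LIP_inv_continuous]. *)
Record LIP (R : realType) (X : metricType R) := {
  LIP_fun :> X -> X;
  LIP_inv : X -> X;
  LIP_funK : cancel LIP_fun LIP_inv;
  LIP_invK : cancel LIP_inv LIP_fun;
  LIP_bilipschitz : exists2 L : R, 1 <= L & bilipschitz L LIP_fun
}.

Lemma lipschitz_continuous (R : realType) (X : metricType R) (L : R) (f : X -> X) :
  1 <= L -> (forall x y, mdist (f x) (f y) <= L * mdist x y) -> continuous f.
Proof.
move=> L1 Lf x; have L0 : 0 < L by rewrite (lt_le_trans ltr01).
apply/metricType_numDomainType.cvgrPdist_lt => e e0.
apply/metricType_numDomainType.nbhs_mdistP; exists (e / L); first by rewrite /= divr_gt0.
move=> y /= xy; rewrite (le_lt_trans (Lf _ _))// mulrC -ltr_pdivlMr//.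
Qed.

Lemma LIP_continuous (R : realType) (X : metricType R) (h : LIP X) : continuous h.
Proof.
have [L L1 hL] := LIP_bilipschitz h.
by apply: (lipschitz_continuous L1) => x y; case: (hL x y).
Qed.

Lemma LIP_inv_continuous (R : realType) (X : metricType R) (h : LIP X) :
  continuous (LIP_inv h).
Proof.
have [L L1 hL] := LIP_bilipschitz h; have L0 := lt_le_trans ltr01 L1.
apply: (lipschitz_continuous L1) => x y; have [+ _] := hL (LIP_inv h x) (LIP_inv h y).
by rewrite !LIP_invK ler_pdivrMr// mulrC.
Qed.

(* A path takes values in [LIP X] at times 0 <= t <= 1; the values of [h] at
   other real numbers play no role. *)
Definition bilipschitz_path (R : realType) (X : metricType R) (h : R -> LIP X) :=
  forall e : R, 0 < e -> exists2 d : R, 0 < d &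
    forall s t : R, 0 <= s <= 1 -> 0 <= t <= 1 -> `|s - t| < d ->
      (forall x : X, mdist (h s (LIP_inv (h t) x)) x < e) /\
      bilipschitz (1 + e) (h s \o LIP_inv (h t)).

(* x |-> x / |x|^2, exchanging 0 and ∞. *)
Definition inversion (R : realType) (n : nat) (p : sphere R n) : sphere R n :=
  if p is Some x then
    if x == 0 then None else Some ((enorm x ^+ 2)^-1 *: x)
  else Some 0.

(* The map f read in R^n, meaningful at the points u such that f u != ∞. *)
Definition affine_part (R : realType) (n : nat) (f : sphere R n -> sphere R n)
  (u : 'rV[R]_n) : 'rV[R]_n := odflt 0 (f (Some u)).

Definition C1_affine (R : realType) (n : nat) (f : sphere R n -> sphere R n) :=
  forall u : 'rV[R]_n, f (Some u) <> None ->
    differentiable (affine_part f) u /\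
    {for u, continuous (jacobian (affine_part f))}.

(* The smooth structure of S^n is given by two charts onto R^n: the identity of
   S^n \ {∞} and the inversion of S^n \ {0}. *)
Definition sphere_chart (R : realType) (n : nat) (b : bool) : sphere R n -> sphere R n :=
  if b then @inversion R n else id.

(* The chart [b] is read at the target and (the inverse of) the chart [a] at the
   source; both [id] and [inversion] are their own inverses. *)
Definition C1_map (R : realType) (n : nat) (f : sphere R n -> sphere R n) :=
  continuous f /\
  forall a b : bool, C1_affine (sphere_chart b \o f \o sphere_chart a).

Definition C1_diffeo (R : realType) (n : nat) (f : sphere R n -> sphere R n) :=
  exists g : sphere R n -> sphere R n,
    [/\ cancel f g, cancel g f, C1_map f & C1_map g].

(* S^n is oriented by R^n. For a C^1 diffeomorphism the Jacobian determinant has a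
   constant sign in oriented charts, so it suffices to look at the chart R^n. *)
Definition diffeo_orientation_preserving (R : realType) (n : nat)
    (f : sphere R n -> sphere R n) :=
  forall u : 'rV[R]_n, f (Some u) <> None -> 0 < \det (jacobian (affine_part f) u).

(* Lebesgue null sets of R^n: balls of the sup norm are cubes. *)
Definition lebesgue_null (R : realType) (n : nat) (N : set 'rV[R]_n) :=
  forall e : R, 0 < e ->
    exists c : nat -> 'rV[R]_n, exists r : nat -> R,
      [/\ forall k, 0 <= r k,
          N `<=` \bigcup_k [set x | `|x - c k| <= r k] &
          forall m, \sum_(k < m) (2 * r k) ^+ n <= e].

(* Bi-Lipschitz maps are differentiable almost everywhere (Rademacher); such a
   homeomorphism preserves the orientation when its Jacobian determinant is
   positive almost everywhere. *)
Definition orientation_preserving (R : realType) (n : nat)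
    (f : sphere R n -> sphere R n) :=
  lebesgue_null [set u : 'rV[R]_n |
    ~ [/\ f (Some u) <> None, differentiable (affine_part f) u &
          0 < \det (jacobian (affine_part f) u)]].

(* LIP(S^n) consists of orientation preserving maps, unlike LIP(X) for a general X. *)
Definition sphere_bilipschitz_path (R : realType) (n : nat)
    (h : R -> LIP (sphere R n)) :=
  bilipschitz_path h /\ forall t : R, 0 <= t <= 1 -> orientation_preserving (h t).

(* Main.v *)
From HB Require Import structures.
Require Import Defs.
From mathcomp Require Import all_boot all_order all_algebra.
From mathcomp Require Import all_classical all_reals all_analysis.
From mathcomp Require Import ring lra zify.
Set Implicit Arguments.
Unset Strict Implicit.
Unset Printing Implicit Defensive.
Import Order.TTheory GRing.Theory Num.Theory.
Import numFieldNormedType.Exports.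
Local Open Scope classical_set_scope.
Local Open Scope ring_scope.

(** A map that is joined to the identity by a bi-Lipschitz path is called isotopic
    to it.  Such maps are closed under composition (follow one path, then the other),
    so it is enough to write [f] as a product of them.

    A compactly supported C^1 diffeomorphism [p] of R^n is isotopic to the identity:
    let [T] be a translation moving the support of [p] off itself and let [P] be the
    product of the conjugates of [p] by [T^k], [k >= 0].  Then
    [p^-1 = T (P T^-1 P^-1)], and both factors belong to one-parameter groups, whose
    increments [P T_(s-t) P^-1] are nearly isometric because the derivative of [P] is
    uniformly continuous.

    If [f v = w], then near [v] the map [f] agrees with a product of compactly
    supported diffeomorphisms: two cut-off translations, a cut-off linear map
    (here det Df(v) > 0 is used) and a cut-off small perturbation of the identity.
    Dividing [f] by them leaves a diffeomorphism that is the identity near a point;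
    the inversion sends this point to infinity, where the map is compactly
    supported. *)

(** The contraction [x |-> t p(x / t)] also deforms [p] to the identity, but in general its
    increments near [t = 0] do not approach isometries, so it is not a bi-Lipschitz path. A
    one-parameter group has the same increments at all times, and conjugating small translations by
    [P] keeps them near the identity together with their derivatives. Although [P] has unbounded
    support, its bounds are uniform because it repeats a single map [p]. The estimates are
    Euclidean; they pass to the chordal metric because the weights sqrt (1 + |x|^2) change by
    factors close to 1. Conjugation by the inversion costs nothing, since the inversion is a chordal
    isometry. The path [A] carries all of [f]; the other two are one path from the identity to
    itself. *)

Ltac mxabel := repeat (let z := fresh "z" in set z := (_ *m _); clearbody z);
  apply/matrixP => ? ?; rewrite !mxE; ring.

(** * Strict derivatives *)

(** Lets row vectors be inferred as a complete normed module, as the Banach fixed point theorem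
    demands. *)
HB.instance Definition _ (R : realType) (m n : nat) := Complete.on 'M[R]_(m, n).

Section sup_norm.
Context {R : realType}.
Implicit Types (m n : nat).

Lemma normr_entry m n (A : 'M[R]_(m, n)) i j : `|A i j| <= `|A|.
Proof.
rewrite [leRHS]/Num.norm/= mx_normrE.
exact: (le_bigmax_cond _ (fun ij : 'I_m * 'I_n => `|A ij.1 ij.2|) (j := (i, j))).
Qed.

Lemma normr_le_entries m n (A : 'M[R]_(m, n)) c :
  0 <= c -> (forall i j, `|A i j| <= c) -> `|A| <= c.
Proof.
by move=> c0 Ac; rewrite [leLHS]/Num.norm/= mx_normrE bigmax_le// => -[i j] _.
Qed.

(** Derivatives act on row vectors from the right; this sum bounds the operator norm of
    [h |-> h *m A] for the sup norm. *)
Definition mxnorm1 m n (A : 'M[R]_(m, n)) : R := \sum_i \sum_j `|A i j|.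

Lemma mxnorm1_ge0 m n (A : 'M[R]_(m, n)) : 0 <= mxnorm1 A.
Proof. by do 2!apply: sumr_ge0 => ? _. Qed.

Lemma normr_mulmx p m n (h : 'M[R]_(p, m)) (A : 'M[R]_(m, n)) :
  `|h *m A| <= mxnorm1 A * `|h|.
Proof.
apply: normr_le_entries => [|i j]; first by rewrite mulr_ge0 ?mxnorm1_ge0.
rewrite mxE (le_trans (ler_norm_sum _ _ _))// mulr_suml ler_sum// => k _.
rewrite normrM mulrC ler_pM ?normr_entry//.
by rewrite (bigD1 j)//= lerDl sumr_ge0.
Qed.

Lemma normr_unitmx m n (A : 'M[R]_n) (h : 'M[R]_(m, n)) :
  A \in unitmx -> `|h| <= mxnorm1 (invmx A) * `|h *m A|.
Proof. by move=> uA; rewrite -{1}(mulmxK uA h) normr_mulmx. Qed.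

Lemma unitmx_injective n (A : 'M[R]_n) :
  (forall h : 'rV_n, h *m A = 0 -> h = 0) -> A \in unitmx.
Proof.
move=> iA; rewrite -row_free_unit -kermx_eq0; apply/eqP/row_matrixP => i.
by rewrite row0; apply: iA; rewrite -row_mul mulmx_ker row0.
Qed.

End sup_norm.

Section strict_derivative.
Context {R : realType}.
Implicit Types (m n p : nat).

(* Strict differentiability at every point is the same as being [C^1], but it
   needs no mean value theorem. *)
Definition sdiff m n (F : 'rV[R]_m -> 'rV[R]_n) (u : 'rV[R]_m) (M : 'M[R]_(m, n)) :=
  forall e : R, 0 < e -> exists2 d : R, 0 < d &
    forall x y : 'rV[R]_m, `|x - u| < d -> `|y - u| < d ->
      `|F x - F y - (x - y) *m M| <= e * `|x - y|.

Lemma sdiff_near m n (F G : 'rV[R]_m -> 'rV[R]_n) u M (r : R) : 0 < r ->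
  (forall x, `|x - u| < r -> F x = G x) -> sdiff F u M -> sdiff G u M.
Proof.
move=> r0 FG dF e /dF[d d0 H]; exists (Num.min d r); first by rewrite lt_min d0.
by move=> x y; rewrite !lt_min => /andP[? ?] /andP[? ?]; rewrite -!FG//; exact: H.
Qed.

Lemma sdiff_id n (u : 'rV[R]_n) : sdiff id u 1%:M.
Proof.
by move=> e e0; exists 1 => // x y _ _; rewrite mulmx1 subrr normr0 mulr_ge0// ltW.
Qed.

Lemma sdiff_cst m n (c : 'rV[R]_n) (u : 'rV[R]_m) : sdiff (fun=> c) u 0.
Proof.
by move=> e e0; exists 1 => // x y _ _; rewrite mulmx0 !subrr normr0 mulr_ge0// ltW.
Qed.

Lemma sdiff_mulmx m n (A : 'M[R]_(m, n)) u : sdiff (mulmx^~ A) u A.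
Proof.
move=> e e0; exists 1 => // x y _ _.
by rewrite -mulmxBl subrr normr0 mulr_ge0// ltW.
Qed.

Lemma sdiffD m n (F G : 'rV[R]_m -> 'rV[R]_n) u A B :
  sdiff F u A -> sdiff G u B -> sdiff (fun x => F x + G x) u (A + B).
Proof.
move=> dF dG e e0; have e20 : 0 < e / 2 by rewrite divr_gt0.
have [d d0 H] := dF _ e20; have [d' d'0 H'] := dG _ e20.
exists (Num.min d d') => [|x y]; first by rewrite lt_min d0.
rewrite !lt_min => /andP[x1 x2] /andP[y1 y2]; rewrite mulmxDr.
have -> : F x + G x - (F y + G y) - ((x - y) *m A + (x - y) *m B) =
  (F x - F y - (x - y) *m A) + (G x - G y - (x - y) *m B).
  by mxabel.
rewrite (le_trans (ler_normD _ _))// [e in leRHS]splitr mulrDl lerD//.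
  exact: H.
exact: H'.
Qed.

Lemma sdiffZ m n (F : 'rV[R]_m -> 'rV[R]_n) u A (a : R) :
  sdiff F u A -> sdiff (fun x => a *: F x) u (a *: A).
Proof.
move=> dF e e0; have a1 : 0 < `|a| + 1 by rewrite ltr_pwDr.
have [d d0 H] := dF _ (divr_gt0 e0 a1); exists d => // x y xu yu.
rewrite -scalemxAr -!scalerBr normrZ.
rewrite (le_trans (ler_wpM2l (normr_ge0 _) (H _ _ xu yu)))// mulrA ler_wpM2r//.
by rewrite mulrCA ler_piMr ?(ltW e0)// ler_pdivrMr// mul1r lerDl.
Qed.

Lemma sdiff_lipschitz m n (F : 'rV[R]_m -> 'rV[R]_n) u M : sdiff F u M ->
  exists2 d : R, 0 < d & forall x y, `|x - u| < d -> `|y - u| < d ->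
    `|F x - F y| <= (mxnorm1 M + 1) * `|x - y|.
Proof.
move=> /(_ _ ltr01)[d d0 H]; exists d => // x y xu yu.
rewrite -[F x - F y](subrK ((x - y) *m M)) (le_trans (ler_normD _ _))// addrC mulrDl.
by rewrite lerD ?normr_mulmx ?H.
Qed.

Lemma sdiff_comp m n p (F : 'rV[R]_m -> 'rV[R]_n) (G : 'rV[R]_n -> 'rV[R]_p) u A B :
  sdiff F u A -> sdiff G (F u) B -> sdiff (G \o F) u (A *m B).
Proof.
move=> dF dG e e0; have [d0 d00 L] := sdiff_lipschitz dF.
set K := mxnorm1 A + 1 in L *; have K0 : 0 < K by rewrite ltr_pwDr ?mxnorm1_ge0.
have [d1 d10 H1] := dG _ (divr_gt0 (divr_gt0 e0 (ltr0n _ 2)) K0).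
have B0 : 0 < mxnorm1 B + 1 by rewrite ltr_pwDr ?mxnorm1_ge0.
have [d2 d20 H2] := dF _ (divr_gt0 (divr_gt0 e0 (ltr0n _ 2)) B0).
exists (Num.min d0 (Num.min d2 (d1 / K))) => [|x y]; first by rewrite !lt_min d00 d20 divr_gt0.
rewrite !lt_min => /and3P[x0 x2 x1] /and3P[y0 y2 y1] /=.
have uu : `|u - u| < d0 by rewrite subrr normr0.
have Fd z : `|z - u| < d0 -> `|z - u| < d1 / K -> `|F z - F u| < d1.
  by move=> z0 z1; rewrite (le_lt_trans (L _ _ z0 uu))// mulrC -ltr_pdivlMr.
have -> : G (F x) - G (F y) - (x - y) *m (A *m B) =
  (G (F x) - G (F y) - (F x - F y) *m B) + (F x - F y - (x - y) *m A) *m B.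
  by rewrite (mulmxBl (F x - F y)) mulmxA; mxabel.
rewrite (le_trans (ler_normD _ _))// [e in leRHS]splitr mulrDl lerD//.
  rewrite (le_trans (H1 _ _ (Fd _ x0 x1) (Fd _ y0 y1)))//.
  by rewrite -(mulrA (e / 2)) ler_pM2l ?divr_gt0// ler_pdivrMl// L.
rewrite (le_trans (normr_mulmx _ _))//.
rewrite (le_trans (ler_wpM2l (mxnorm1_ge0 _) (H2 _ _ x2 y2)))// mulrA ler_wpM2r//.
rewrite mulrCA ler_piMr ?divr_ge0 ?ltW// ltr_pdivrMr// mul1r ltrDl//.
Qed.

(** By homogeneity the bound near 0 holds for basis vectors, after scaling by [c], with every
    [e]. *)
Lemma mulmx_small m n (A : 'M[R]_(m, n)) :
  (forall e, 0 < e -> exists2 d, 0 < d &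
     forall h : 'rV_m, `|h| < d -> `|h *m A| <= e * `|h|) -> A = 0.
Proof.
move=> H; apply/row_matrixP => i; rewrite row0 rowE.
set h := delta_mx 0 i; apply/eqP; rewrite -normr_le0; apply/ler_addgt0Pr => e e0.
have h1 : 0 < `|h| + 1 by rewrite ltr_pwDr.
have [d d0 Hd] := H _ (divr_gt0 e0 h1).
have [c c0 cE] : exists2 c, 0 < c & c * (`|h| + 1) = d.
  by exists (d / (`|h| + 1)); rewrite ?divr_gt0// mulfVK ?gt_eqF.
have := Hd (c *: h); rewrite -scalemxAl !normrZ (gtr0_norm c0) => K; rewrite add0r.
rewrite -(ler_pM2l c0) (le_trans (K _))//.
  by rewrite -cE ltr_pM2l// ltrDl.
rewrite mulrCA ler_pM2l// -mulrA ler_piMr ?(ltW e0)//.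
by rewrite mulrC ler_pdivrMr// mul1r lerDl.
Qed.

Lemma sdiff_uniq m n (F : 'rV[R]_m -> 'rV[R]_n) u A B :
  sdiff F u A -> sdiff F u B -> A = B.
Proof.
move=> dA dB; apply/eqP; rewrite -subr_eq0; apply/eqP/mulmx_small => e e0.
have e20 : 0 < e / 2 by rewrite divr_gt0.
have [d d0 H] := dA _ e20; have [d' d'0 H'] := dB _ e20.
exists (Num.min d d') => [|h]; first by rewrite lt_min d0.
rewrite lt_min => /andP[h1 h2].
have := H (u + h) u; have := H' (u + h) u.
rewrite subrr normr0 addrAC subrr add0r => /(_ h2 d'0) K' /(_ h1 d0) K.
have -> : h *m (A - B) = (F (u + h) - F u - h *m B) - (F (u + h) - F u - h *m A).
  by rewrite mulmxBr; mxabel.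
by rewrite (le_trans (ler_normB _ _))// [e in leRHS]splitr mulrDl lerD.
Qed.

(** The error of [G] at [x], [y] is minus the error of [F] at [G x], [G y], multiplied by [invmx M];
    the Lipschitz bound turns it into a small multiple of |x - y|. *)
Lemma sdiff_inverse n (F G : 'rV[R]_n -> 'rV[R]_n) u M (L : R) :
  cancel G F -> (forall x y, `|G x - G y| <= L * `|x - y|) ->
  M \in unitmx -> sdiff F (G u) M -> sdiff G u (invmx M).
Proof.
move=> GK GL uM dF e e0.
pose L1 := `|L| + 1; have L10 : 0 < L1 by rewrite ltr_pwDr.
have {}GL x y : `|G x - G y| <= L1 * `|x - y|.
  rewrite (le_trans (GL _ _))// ler_wpM2r//.
  by rewrite (le_trans (ler_norm _))// lerDl.
pose K := mxnorm1 (invmx M) + 1; have K0 : 0 < K by rewrite ltr_pwDr ?mxnorm1_ge0.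
have [d d0 H] := dF _ (divr_gt0 e0 (mulr_gt0 K0 L10)).
exists (d / L1) => [|x y xu yu]; first by rewrite divr_gt0.
have Gd z : `|z - u| < d / L1 -> `|G z - G u| < d.
  by move=> zu; rewrite (le_lt_trans (GL _ _))// mulrC -ltr_pdivlMr.
have := H _ _ (Gd _ xu) (Gd _ yu); rewrite !GK => H'.
have -> : G x - G y - (x - y) *m invmx M = - ((x - y - (G x - G y) *m M) *m invmx M).
  by rewrite [in RHS]mulmxBl mulmxK// opprB.
rewrite normrN (le_trans (normr_mulmx _ _))//.
rewrite (le_trans (ler_wpM2l (mxnorm1_ge0 _) H'))//.
rewrite (le_trans (ler_wpM2l (mxnorm1_ge0 _) (ler_wpM2l _ (GL x y))))//.
  by rewrite ltW// divr_gt0// mulr_gt0.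
rewrite !mulrA ler_wpM2r// invfM !mulrA mulfVK ?gt_eqF//.
by rewrite ler_pdivrMr// mulrC ler_pM2l// lerDl.
Qed.

(** Along a kernel vector of [M] the change of [F] is only o(|h|), against expansion. The tolerance
    [1 / (2 * c1)] yields |a h| <= |a h| / 2. *)
Lemma sdiff_unitmx m n (F : 'rV[R]_n -> 'rV[R]_m) u M (c d : R) : 0 < d ->
  (forall x y, `|x - u| < d -> `|y - u| < d -> `|x - y| <= c * `|F x - F y|) ->
  sdiff F u M -> forall h : 'rV_n, h *m M = 0 -> h = 0.
Proof.
move=> d0 Fc dF h hM.
pose c1 := `|c| + 1; have c10 : 0 < c1 by rewrite ltr_pwDr.
have [d' d'0 H] := dF _ (divr_gt0 (ltr01) (mulr_gt0 (ltr0n _ 2) c10)).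
have h10 : 0 < `|h| + 1 by rewrite ltr_pwDr.
pose a := Num.min d d' / (`|h| + 1).
have a0 : 0 < a by rewrite divr_gt0// lt_min d0.
have : `|a *: h| < Num.min d d'.
  rewrite normrZ gtr0_norm// /a -mulrA -ltr_pdivlMl ?lt_min ?d0//.
  by rewrite mulVf ?gt_eqF ?lt_min ?d0// ltr_pdivrMl ?mulr1 ?ltrDl.
rewrite lt_min => /andP[hd hd'].
have := H (u + a *: h) u; have := Fc (u + a *: h) u.
rewrite subrr normr0 addrAC subrr add0r -scalemxAl hM scaler0 subr0.
move=> /(_ hd d0) K /(_ hd' d'0) K'.
have {}K : `|a *: h| <= c1 * `|F (u + a *: h) - F u|.
  rewrite (le_trans K)// ler_wpM2r//.
  by rewrite (le_trans (ler_norm _))// lerDl.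
have : `|a *: h| <= `|a *: h| / 2.
  rewrite (le_trans K)// (le_trans (ler_wpM2l (ltW c10) K'))//.
  by rewrite invfM mulrA mul1r mulrCA divff ?gt_eqF// mulr1 mulrC.
move=> ah; have /eqP : `|a *: h| = 0 by have := normr_ge0 (a *: h); lra.
by rewrite normr_eq0 scaler_eq0 (gt_eqF a0) => /eqP.
Qed.

End strict_derivative.

(** * Products, the squared norm, the inverse and a C^1 cut-off function *)

Section strict_derivative_examples.
Context {R : realType}.
Implicit Types (m n p : nat).

Lemma sdiff_continuous m n (F : 'rV[R]_m -> 'rV[R]_n) u M e : sdiff F u M -> 0 < e ->
  exists2 d : R, 0 < d & forall x, `|x - u| < d -> `|F x - F u| < e.
Proof.
move=> /sdiff_lipschitz[d d0 L] e0.
have K0 : 0 < mxnorm1 M + 1 by rewrite ltr_pwDr ?mxnorm1_ge0.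
exists (Num.min d (e / (mxnorm1 M + 1))) => [|x]; first by rewrite lt_min d0 divr_gt0.
rewrite lt_min => /andP[xd xe]; rewrite (le_lt_trans (L _ _ xd _)) ?subrr ?normr0//.
by rewrite mulrC -ltr_pdivlMr.
Qed.

Lemma normr_mx11 (a : 'M[R]_1) : `|a| = `|a 0 0|.
Proof.
apply/eqP; rewrite eq_le normr_entry andbT normr_le_entries// => i j.
by rewrite !ord1.
Qed.

Lemma mulmx11 n (a : 'M[R]_1) (v : 'rV[R]_n) : a *m v = a 0 0 *: v.
Proof. by rewrite [a in LHS]mx11_scalar mul_scalar_mx. Qed.

(** Scalar functions take values in 1 x 1 matrices, so that [sdiff] covers them and [*m] multiplies
    them with vectors. *)
Lemma sdiff_mul m n (f : 'rV[R]_m -> 'rV[R]_1) (F : 'rV[R]_m -> 'rV[R]_n) u E A :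
  sdiff f u E -> sdiff F u A ->
  sdiff (fun x => f x *m F x) u (E *m F u + f u 0 0 *: A).
Proof.
move=> df dF e e0; pose K := 1 + `|F u| + `|f u| + mxnorm1 A + mxnorm1 E.
have [A0 E0] := (mxnorm1_ge0 A, mxnorm1_ge0 E).
have [Fu0 fu0] := (normr_ge0 (F u), normr_ge0 (f u)).
have K0 : 0 < K by rewrite /K; lra.
(* Each of the four error terms below is at most e' K |h|. *)
have [e' e'0 e'E] : exists2 e', 0 < e' & e' * K * 4 = e.
  by exists (e / (K * 4)); rewrite ?divr_gt0 ?mulr_gt0// -mulrA mulfVK// gt_eqF ?mulr_gt0.
have m0 : 0 < Num.min 1 e' by rewrite lt_min ltr01.
have [d1 d10 H1] := df _ e'0; have [d2 d20 H2] := dF _ e'0.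
have [d3 d30 H3] := sdiff_continuous df m0.
have [d4 d40 H4] := sdiff_continuous dF m0.
exists (Num.min (Num.min d1 d2) (Num.min d3 d4)) => [|x y].
  by rewrite !lt_min d10 d20 d30.
rewrite !lt_min => /andP[/andP[x1 x2] /andP[x3 x4]] /andP[/andP[y1 y2] /andP[y3 y4]].
have {}H1 := H1 _ _ x1 y1; have {}H2 := H2 _ _ x2 y2.
have := H3 _ y3; have := H4 _ x4.
rewrite !lt_min => /andP[Fx1 Fxe] /andP[fy1 fye].
have FxK : `|F x| <= K.
  rewrite -(subrK (F u) (F x)) (le_trans (ler_normD _ _))// /K; lra.
have fyK : `|f y| <= K.
  rewrite -(subrK (f u) (f y)) (le_trans (ler_normD _ _))// /K; lra.
set h := x - y in H1 H2 *; have h0 := normr_ge0 h.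
have -> : f x *m F x - f y *m F y - h *m (E *m F u + f u 0 0 *: A) =
   (f x - f y - h *m E) *m F x + (h *m E) *m (F x - F u)
   + f y *m (F x - F y - h *m A) + (f y - f u) *m (h *m A).
  rewrite mulmxDr -scalemxAr -mulmx11 mulmxA !mulmxBl !mulmxBr.
  by mxabel.
have B (a : 'M[R]_1) p (v : 'rV[R]_p) c d : `|a| <= c -> `|v| <= d -> `|a *m v| <= c * d.
  by move=> ac vd; rewrite mulmx11 normrZ -normr_mx11 ler_pM.
have hE : `|h *m E| <= K * `|h|.
  by rewrite (le_trans (normr_mulmx _ _))// ler_wpM2r// /K; lra.
have hA : `|h *m A| <= K * `|h|.
  by rewrite (le_trans (normr_mulmx _ _))// ler_wpM2r// /K; lra.
have := B _ _ _ _ _ H1 FxK; have := B _ _ _ _ _ hE (ltW Fxe).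
have := B _ _ _ _ _ fyK H2; have := B _ _ _ _ _ (ltW fye) hA.
rewrite -e'E => T4 T3 T2 T1.
do 3!rewrite (le_trans (ler_normD _ _))// -?lerBrDr.
lra.
Qed.

Lemma sdiff_sqnorm n (u : 'rV[R]_n) : sdiff (fun x => x *m x^T) u (2 *: u^T).
Proof.
move=> e e0; pose c : R := (n%:R + 1) * 2.
have c0 : 0 < c by rewrite mulr_gt0// ltr_pwDr.
exists (e / c); first by rewrite divr_gt0.
move=> x y xu yu.
have -> : x *m x^T - y *m y^T - (x - y) *m (2 *: u^T) =
    (x - y) *m ((x - u) + (y - u))^T.
  apply/matrixP => i j; rewrite ord1 [j]ord1 !mxE -!sumrB; apply: eq_bigr => k _.
  by rewrite !mxE; ring.
rewrite normr_mx11 mxE (le_trans (ler_norm_sum _ _ _))//.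
apply: (@le_trans _ _ (\sum_(k < n) `|x - y| * (2 * (e / c)))).
  apply: ler_sum => k _; rewrite normrM ler_pM ?normr_entry//.
  rewrite mxE (le_trans (normr_entry _ _ _))// (le_trans (ler_normD _ _))//.
  by rewrite mulrDl mul1r lerD// ltW.
rewrite sumr_const card_ord -[leLHS]mulr_natl [leLHS]mulrCA mulrC ler_wpM2r//.
have -> : n%:R * (2 * (e / c)) = e * (n%:R * 2 / c) by ring.
rewrite ler_piMr ?(ltW e0)// ler_pdivrMr// mul1r /c ler_pM2r// lerDl//.
Qed.

Lemma sdiff_mx11 (b : R -> R) (u : 'rV[R]_1) c :
  (forall e : R, 0 < e -> exists2 d : R, 0 < d & forall s t,
     `|s - u 0 0| < d -> `|t - u 0 0| < d -> `|b s - b t - c * (s - t)| <= e * `|s - t|) ->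
  sdiff (fun x : 'rV[R]_1 => (b (x 0 0))%:M) u c%:M.
Proof.
move=> H e /H[d d0 {}H]; exists d => // x y xu yu.
have E (z : 'rV[R]_1) : `|z - u| < d -> `|z 0 0 - u 0 0| < d.
  by move=> zu; rewrite (le_lt_trans _ zu)// normr_mx11 !mxE.
have := H _ _ (E _ xu) (E _ yu).
by rewrite !normr_mx11 mul_mx_scalar !mxE !mulr1n.
Qed.

Lemma inv_sdiff (a e : R) : 0 < a -> 0 < e -> exists2 d : R, 0 < d & forall s t,
  `|s - a| < d -> `|t - a| < d -> `|s^-1 - t^-1 - (- a ^- 2) * (s - t)| <= e * `|s - t|.
Proof.
(* The radius [a / 2] gives s t >= a^2 / 4; the second bound gives |s t - a^2| <= 3 a (e a^3 / 12) =
   e a^2 (a^2 / 4). *)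
move=> a0 e0; exists (Num.min (a / 2) (e * a ^+ 3 / 12)).
  by rewrite lt_min !divr_gt0// mulr_gt0// exprn_gt0.
move=> s t; rewrite !lt_min => /andP[s1 s2] /andP[t1 t2].
have [sa ta] : a / 2 < s /\ a / 2 < t.
  by move: s1 t1; rewrite !ltr_norml; lra.
have [sa' ta'] : s < a * 3 / 2 /\ t < a * 3 / 2.
  by move: s1 t1; rewrite !ltr_norml; lra.
have [s0 t0] : 0 < s /\ 0 < t by lra.
have -> : s^-1 - t^-1 - (- a ^- 2) * (s - t) = (s - t) * ((s * t - a ^+ 2) / (a ^+ 2 * (s * t))).
  by field; rewrite !gt_eqF.
rewrite normrM mulrC ler_wpM2r// normrM [X in _ * X]gtr0_norm ?invr_gt0 ?mulr_gt0 ?exprn_gt0//.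
rewrite ler_pdivrMr ?mulr_gt0 ?exprn_gt0//.
have -> : s * t - a ^+ 2 = s * (t - a) + a * (s - a) by ring.
rewrite (le_trans (ler_normD _ _))// !normrM (gtr0_norm s0) (gtr0_norm a0).
have a3 : a ^+ 3 = a * a ^+ 2 by rewrite exprS.
have a20 : 0 < a ^+ 2 by rewrite exprn_gt0.
set S := `|s - a| in s2 *; set T := `|t - a| in t2 *.
have [S0 T0] : 0 <= S /\ 0 <= T by split; exact: normr_ge0.
have st : a ^+ 2 / 4 <= s * t.
  have -> : a ^+ 2 / 4 = (a / 2) * (a / 2) by field.
  by rewrite ler_pM ?divr_ge0// ltW.
apply: (@le_trans _ _ (3 * a * (e * a ^+ 3 / 12))).
  have : s * T <= (a * 3 / 2) * (e * a ^+ 3 / 12) by rewrite ler_pM// ltW.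
  have : a * S <= a * (e * a ^+ 3 / 12) by rewrite ler_pM2l// ltW.
  have : 0 < a * (e * a ^+ 3 / 12) by rewrite !mulr_gt0// exprn_gt0.
  by lra.
have -> : 3 * a * (e * a ^+ 3 / 12) = e * (a ^+ 2 * (a ^+ 2 / 4)) by field.
by rewrite !ler_pM2l.
Qed.

Lemma sdiff_inv (u : 'rV[R]_1) : 0 < u 0 0 ->
  sdiff (fun x : 'rV[R]_1 => ((x 0 0)^-1)%:M) u (- (u 0 0) ^- 2)%:M.
Proof. by move=> u0; apply: sdiff_mx11 => e e0; exact: inv_sdiff. Qed.

(** The square of the positive part is C^1 with derivative [2 * Num.max s 0]; two of them, nested,
    flatten [cutoff] at both ends. *)
Definition sqpos (s : R) : R := (Num.max s 0) ^+ 2.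

Lemma sqposP (a s t : R) : `|sqpos s - sqpos t - 2 * Num.max a 0 * (s - t)|
   <= 2 * (`|s - a| + `|t - a|) * `|s - t|.
Proof.
wlog ts : s t / t <= s.
  move=> H; case: (leP t s) => [/H//|/ltW/H]; rewrite [`|t - s|]distrC [`|t - a| + _]addrC.
  by congr (_ <= _); rewrite -normrN; congr `|_|; ring.
have [S0 T0] := (normr_ge0 (s - a), normr_ge0 (t - a)).
have [s1 s2] : - `|s - a| <= s - a /\ s - a <= `|s - a| by apply/andP; rewrite -ler_norml.
have [t1 t2] : - `|t - a| <= t - a /\ t - a <= `|t - a| by apply/andP; rewrite -ler_norml.
rewrite [`|s - t|]ger0_norm ?subr_ge0// /sqpos.
move: `|s - a| `|t - a| S0 T0 s1 s2 t1 t2 => S T S0 T0 s1 s2 t1 t2.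
rewrite ler_norml /Num.max.
have h0 : 0 <= s - t by rewrite subr_ge0.
case: ltP => s0; case: ltP => t0; case: ltP => a0; apply/andP; split; try lra; nra.
Qed.

Lemma sdiff_sqpos (u : 'rV[R]_1) :
  sdiff (fun x : 'rV[R]_1 => (sqpos (x 0 0))%:M) u (2 * Num.max (u 0 0) 0)%:M.
Proof.
apply: sdiff_mx11 => e e0; exists (e / 4); first by rewrite divr_gt0.
move=> s t sa ta; rewrite (le_trans (sqposP _ _ _))// ler_wpM2r//; lra.
Qed.

Definition cutoff n (x : 'rV[R]_n) : 'rV[R]_1 :=
  (sqpos (1 - sqpos ((x *m x^T) 0 0 - 1)))%:M.

Lemma sdiff_cutoff n (u : 'rV[R]_n) : exists E, sdiff (@cutoff n) u E.
Proof.
have dN := sdiffD (sdiff_sqnorm u) (sdiff_cst (- 1%:M) u).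
have := sdiffZ (-1) (sdiff_comp dN (sdiff_sqpos _)).
move/(fun h => sdiffD h (sdiff_cst 1%:M u)).
move/(fun h => sdiff_comp h (sdiff_sqpos _)) => dF.
eexists; apply: sdiff_near ltr01 _ dF => x _ /=.
by rewrite /cutoff !mxE /= !mulr1n mulN1r addrC.
Qed.

Lemma cutoff1 n (x : 'rV[R]_n) : (x *m x^T) 0 0 <= 1 -> cutoff x = 1%:M.
Proof.
move=> x1; rewrite /cutoff /sqpos (@max_r _ _ (_ - 1)) ?subr_le0// expr0n/= subr0.
by rewrite max_l// expr1n.
Qed.

Lemma cutoff0 n (x : 'rV[R]_n) : 2 <= (x *m x^T) 0 0 -> cutoff x = 0.
Proof.
move=> x2; rewrite /cutoff /sqpos (@max_l _ _ (_ - 1)); last by lra.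
rewrite max_r ?expr0n/= ?raddf0// subr_le0; nra.
Qed.

End strict_derivative_examples.

(** * Matrices of positive determinant *)

Section determinants.
Context {R : realType}.

(** Serves for the Jacobian of the inversion. Two triangular factorizations of one block matrix are
    compared. *)
Lemma det_rank1_update n (c : 'cV[R]_n) (r : 'rV[R]_n) :
  \det (1%:M + c *m r) = 1 + (r *m c) 0 0.
Proof.
have E1 : block_mx 1%:M (- r) c 1%:M =
   block_mx 1%:M 0 c 1%:M *m block_mx 1%:M (- r) 0 (1%:M + c *m r).
  by rewrite mulmx_block !(mulmx1, mul1mx, mulmx0, mul0mx, addr0, add0r) mulmxN addrCA addNr addr0.
have E2 : block_mx 1%:M (- r) c 1%:M =
   block_mx (1%:M + r *m c) (- r) 0 1%:M *m block_mx 1%:M 0 c 1%:M.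
  by rewrite mulmx_block !(mulmx1, mul1mx, mulmx0, mul0mx, addr0, add0r) mulNmx addrK.
have := congr1 (fun M => \det M) E1; rewrite [in LHS]E2.
rewrite !det_mulmx !det_ublock !det_lblock !det1 !(mul1r, mulr1) det_mx11 => <-.
by rewrite !mxE.
Qed.

(** The determinant along the segment is a polynomial in [s] with value 1 at 0; a value <= 0 at 1
    would force a root in [0, 1]. *)
Lemma det_segment_gt0 n (M : 'M[R]_n) :
  (forall s : R, 0 <= s <= 1 -> (1 - s)%:M + s *: M \in unitmx) -> 0 < \det M.
Proof.
move=> H; rewrite ltNge; apply/negP => M0.
pose P : 'M[{poly R}]_n := \matrix_(i, j) ((1%:M i j)%:P + 'X * ((M - 1%:M) i j)%:P).
have PE s : (\det P).[s] = \det ((1 - s)%:M + s *: M).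
  rewrite -[LHS]/(horner_eval s (\det P)) -det_map_mx; congr (\det _).
  apply/matrixP => i j; rewrite mxE; change ((P i j).[s] = ((1 - s)%:M + s *: M) i j).
  rewrite !mxE hornerD hornerM hornerX !hornerC.
  by case: (i == j); rewrite ?mulr1n ?mulr0n; ring.
have P0 : (- \det P).[0] = -1 by rewrite hornerN PE subr0 scale0r addr0 det1.
have P1 : (- \det P).[1] = - \det M by rewrite hornerN PE subrr raddf0 add0r scale1r.
have [||s s01] := @Num.Theory.poly_ivt R (- \det P) 0 1.
- by [].
- by rewrite P0 P1 oppr_ge0 M0 andbT lerN10.
rewrite rootE hornerN PE oppr_eq0 => /eqP d0; have := H s s01.
by rewrite unitmxE d0 unitr0.
Qed.

(** A kernel vector on the segment from 1 to [B] satisfies h = - s (h B - h), hence |h| <= e |h|. *)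
Lemma det_near1_gt0 n (B : 'M[R]_n) (e : R) : e < 1 ->
  (forall z : 'rV_n, `|z *m B - z| <= e * `|z|) -> 0 < \det B.
Proof.
move=> e1 H; apply: det_segment_gt0 => s /andP[s0 s1].
apply: unitmx_injective => h; rewrite mulmxDr mul_mx_scalar -scalemxAr => h0.
have hE : h = - (s *: (h *m B - h)).
  apply/eqP; rewrite -addr_eq0 scalerBr; apply/eqP; rewrite -[RHS]h0 scalerBl scale1r.
  by mxabel.
have : `|h| <= s * (e * `|h|).
  rewrite [in leLHS]hE normrN normrZ ger0_norm// ler_wpM2l//.
have := normr_ge0 h => hh0 hle; apply/eqP; rewrite -normr_le0.
have := H h; have := normr_ge0 (h *m B - h) => k0 k1.
have [//|hp] := leP `|h| 0.
have : `|h| <= e * `|h| by rewrite (le_trans hle)// ler_piMl// (le_trans k0 k1).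
by rewrite -subr_ge0 -{2}[`|h|]mul1r -mulrBl pmulr_lge0// subr_ge0 leNgt e1.
Qed.

End determinants.

Section positive_determinant.
Context {R : realType}.

Let lower n (c : 'cV[R]_n) : 'M[R]_(1 + n) := block_mx 1%:M 0 c 1%:M.
Let upper n (r : 'rV[R]_n) : 'M[R]_(1 + n) := block_mx 1%:M r 0 1%:M.

(** Matrices joined to 1 by a segment of invertible ones are the generators: transvections are among
    them, and [compact_linear] can follow the segment in small steps. *)
Let unit_segment n (P : 'M[R]_n -> Prop) := forall M : 'M[R]_n,
  (forall s : R, 0 <= s <= 1 -> (1 - s)%:M + s *: M \in unitmx) -> P M.

Let seg_scalar n (s : R) : (1 - s)%:M + s *: 1%:M = 1%:M :> 'M[R]_n.
Proof. by rewrite scalemx1 -raddfD/= subrK. Qed.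

Let segment_lower n (P : 'M[R]_(1 + n) -> Prop) c : unit_segment P -> P (lower c).
Proof.
move=> HP; apply: HP => s _; rewrite /lower scale_block_mx -[(1 - s)%:M]submxK.
rewrite scalar_mx_block block_mxKul block_mxKur block_mxKdl block_mxKdr add_block_mx.
rewrite !scaler0 !addr0 !seg_scalar unitmxE det_lblock !det1 mulr1 unitr1//.
Qed.

Let segment_upper n (P : 'M[R]_(1 + n) -> Prop) r : unit_segment P -> P (upper r).
Proof.
move=> HP; apply: HP => s _; rewrite /upper scale_block_mx -[(1 - s)%:M]submxK.
rewrite scalar_mx_block block_mxKul block_mxKur block_mxKdl block_mxKdr add_block_mx.
rewrite !scaler0 !addr0 !seg_scalar unitmxE det_ublock !det1 mulr1 unitr1//.
Qed.

Let lowerK n (c : 'cV[R]_n) : lower (- c) *m lower c = 1%:M.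
Proof.
rewrite /lower mulmx_block !(mulmx1, mul1mx, mulmx0, mul0mx, addr0, add0r) addNr.
by rewrite -scalar_mx_block.
Qed.

Let upperK n (r : 'rV[R]_n) : upper (- r) *m upper r = 1%:M.
Proof.
rewrite /upper mulmx_block !(mulmx1, mul1mx, mulmx0, mul0mx, addr0, add0r) subrr.
by rewrite -scalar_mx_block.
Qed.

(* Gaussian elimination with transvections brings a matrix of positive
   determinant to the form diag(1, ..., 1, d) with [0 < d]. *)
Lemma det_gt0_ind n (P : 'M[R]_n -> Prop) :
  (forall A B, P A -> P B -> P (A *m B)) ->
  (forall M : 'M[R]_n,
    (forall s : R, 0 <= s <= 1 -> (1 - s)%:M + s *: M \in unitmx) -> P M) ->
  forall M, 0 < \det M -> P M.
Proof.
elim: n P => [|[|n] IH] P PM PS M M0.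
- by apply: PS => s _; rewrite unitmxE det_mx00 unitr1.
- apply: PS => s /andP[s0 s1]; rewrite unitmxE unitfE gt_eqF// det_mx11 !mxE.
  rewrite det_mx11 in M0; rewrite mulr1n.
  have [->|sn0] := eqVneq s 0; first by rewrite mul0r subr0 addr0.
  by rewrite ltr_wpDl ?subr_ge0// mulr_gt0// lt0r sn0.
change ('M[R]_(1 + n.+1)) in M; change ('M[R]_(1 + n.+1) -> Prop) in P.
change (forall A B : 'M[R]_(1 + n.+1), P A -> P B -> P (A *m B)) in PM.
have {}PS : unit_segment P := PS.
have det_lower c : \det (lower c : 'M[R]_(1 + n.+1)) = 1 by rewrite det_lblock !det1 mulr1.
have det_upper r : \det (upper r : 'M[R]_(1 + n.+1)) = 1 by rewrite det_ublock !det1 mulr1.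
(* Pivot 1: two transvections split off; the Schur complement [D - c *m r] has the same determinant
   and is left to the induction. *)
have step1 r c D : 0 < \det (block_mx 1%:M r c D : 'M[R]_(1 + n.+1)) ->
    P (block_mx 1%:M r c D).
  move=> d0; have E : block_mx 1%:M r c D =
      lower c *m block_mx 1%:M 0 0 (D - c *m r) *m upper r.
    rewrite /lower /upper !mulmx_block.
    by rewrite !(mulmx1, mul1mx, mulmx0, mul0mx, addr0, add0r) addrC subrK.
  rewrite E; apply: (PM _ _ _ (segment_upper _ PS)); apply: (PM _ _ (segment_lower _ PS)).
  apply: (IH (fun D => P (block_mx 1%:M 0 0 D))).
  - move=> A B PA PB; have := PM _ _ PA PB.
    by rewrite mulmx_block !(mulmx1, mul1mx, mulmx0, mul0mx, addr0, add0r).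
  - move=> A HA; apply: PS => s /HA uA.
    rewrite scale_block_mx -[(1 - s)%:M]submxK.
    rewrite scalar_mx_block block_mxKul block_mxKur block_mxKdl block_mxKdr add_block_mx.
    by rewrite !scaler0 !addr0 !seg_scalar unitmxE det_ublock !det1 mul1r -unitmxE.
  - move: d0; rewrite E !det_mulmx det_lower det_upper mul1r mulr1.
    by rewrite det_ublock det1 mul1r.
(* Nonzero column [c]: the row [w] solves [a + w *m c = 1], so a transvection makes the pivot 1. *)
have step2 a r c D : c != 0 -> 0 < \det (block_mx a r c D : 'M[R]_(1 + n.+1)) ->
    P (block_mx a r c D).
  move=> /cV0Pn[i ci] d0; pose w : 'rV[R]_n.+1 := ((1 - a 0 0) / c i 0) *: delta_mx 0 i.
  rewrite -[block_mx _ _ _ _]mul1mx -(upperK w) -mulmxA.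
  apply: (PM _ _ (segment_upper _ PS)); move: d0.
  rewrite -[ltRHS]mul1r -(det_upper w) -det_mulmx /upper mulmx_block.
  rewrite !(mulmx1, mul1mx, mulmx0, mul0mx, addr0, add0r).
  suff -> : a + w *m c = 1%:M by exact: step1.
  apply/matrixP => k l; rewrite !ord1 !mxE (bigD1 i)//= big1 => [|j ji].
    by rewrite !mxE !eqxx mulr1 addr0 mulfVK// addrC subrK.
  by rewrite !mxE (negbTE ji) andbF mulr0 mul0r.
rewrite -(submxK M) in M0 *.
move: (ulsubmx M) (ursubmx M) (dlsubmx M) (drsubmx M) M0 => a r c D d0.
(* If [c = 0], the pivot [a] is nonzero, and adding the first row to the next one makes the column
   nonzero. *)
have [c0|] := eqVneq c 0; last by move=> /step2; exact.
have a0 : a 0 0 != 0.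
  apply/eqP => a0; move: d0; rewrite c0 (det_ublock a r D) det_mx11 a0 mul0r ltxx//.
pose v : 'cV[R]_n.+1 := delta_mx 0 0.
rewrite -[block_mx _ _ _ _]mul1mx -(lowerK v) -mulmxA.
apply: (PM _ _ (segment_lower _ PS)); move: d0.
rewrite -[ltRHS]mul1r -(det_lower v) -det_mulmx /lower mulmx_block.
rewrite !(mulmx1, mul1mx, mulmx0, mul0mx, addr0, add0r); apply: step2.
apply/cV0Pn; exists 0; rewrite c0 addr0 [a]mx11_scalar mul_mx_scalar !mxE eqxx mulr1//.
Qed.

End positive_determinant.

(** * Comparison with differentials and Jacobian matrices *)

Section bridge.
Context {R : realType}.
Implicit Types (m n : nat).

Lemma mulmxr_continuous m n (M : 'M[R]_(m, n)) :
  continuous (mulmxr M : 'rV[R]_m -> 'rV[R]_n).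
Proof.
apply/linear_bounded_continuous/bounded_funP => r; exists (mxnorm1 M * r) => x xr.
by rewrite (le_trans (normr_mulmx _ _))// ler_wpM2l// mxnorm1_ge0.
Qed.

Lemma sdiff_differentiable m n (F : 'rV[R]_m -> 'rV[R]_n) u M :
  sdiff F u M -> differentiable F u /\ jacobian F u = M.
Proof.
move=> dF; have Mc := @mulmxr_continuous _ _ M.
have Fo : F \o shift u = cst (F u) + (mulmxr M : 'rV[R]_m -> 'rV[R]_n) +o_ 0 id.
  apply/eqaddoP => _/posnumP[e]; have [d d0 H] := dF _ (gt0 e).
  apply/nbhs_ballP; exists d => //= h; rewrite -ball_normE /= sub0r normrN => hd.
  have := H (h + u) u; rewrite addrK subrr normr0 => /(_ hd d0).
  by rewrite /= -[X in `|X| <= _ -> _]addrA -opprD.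
have dE := diff_unique Mc Fo; split; last first.
  apply/row_matrixP => i; rewrite !rowE /jacobian mul_rV_lin1.
  by have := congr1 (fun f => f (delta_mx 0 i)) dE.
by apply/diff_locallyP; rewrite dE.
Qed.

(** The intermediate point depends on the coordinate [j], so estimates have to be made entry by
    entry. *)
Lemma mean_value_rV m n (F : 'rV[R]_m -> 'rV[R]_n) (x y : 'rV[R]_m) (j : 'I_n) :
  (forall t : R, 0 <= t <= 1 -> differentiable F (y + t *: (x - y))) ->
  exists2 t : R, 0 <= t <= 1 &
    (F x - F y) 0 j = ((x - y) *m jacobian F (y + t *: (x - y))) 0 j.
Proof.
move=> dF; pose a (t : R) := y + t *: (x - y); pose g (t : R) : R := F (a t) 0 j.
have ga (t : R) : 0 <= t <= 1 ->
    is_diff t g (fun s : R => (s *: (x - y) *m jacobian F (a t)) 0 j).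
  move=> t01.
  have c1 : is_diff t a (fun s : R => s *: (x - y)).
    by apply: is_diff_eq; rewrite funeqE => s /=; rewrite add0r.
  have c2 : is_diff (a t) F ('d F (a t)) by apply: differentiableP; exact: dF.
  have c3 := is_diff_comp c1 c2.
  have c4 : is_diff (F (a t)) (fun N : 'rV[R]_n => N 0 j : R) (fun N : 'rV[R]_n => N 0 j).
    have cc : continuous (fun N : 'rV[R]_n => N 0 j : R) by exact: coord_continuous.
    have l : linear (fun N : 'rV[R]_n => N 0 j : R^o) by move=> c u v; rewrite !mxE.
    pose lM := GRing.isLinear.Build _ _ _ _ _ l.
    pose lL : {linear 'rV[R]_n -> R^o} := HB.pack (fun N : 'rV[R]_n => N 0 j : R^o) lM.
    apply: DiffDef; first exact: (@linear_differentiable _ _ _ lL).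
    exact: (@diff_lin _ _ _ lL).
  have := is_diff_comp c3 c4 => c5.
  apply: is_diff_eq c5 _; rewrite funeqE => s /=.
  by rewrite mul_rV_lin1.
pose dg (t : R) := ((x - y) *m jacobian F (a t)) 0 j.
have dgt (t : R) : 0 <= t <= 1 -> is_derive t 1 g (dg t).
  move=> /ga [dg1 dg2]; apply: DeriveDef; first exact: diff_derivable.
  by rewrite deriveE// dg2 scale1r.
have [t|| t t01 gE] := @MVT_segment R g dg 0 1 ler01.
- by rewrite in_itv/= => /andP[/ltW t0 /ltW t1]; apply: dgt; rewrite t0.
- apply: derivable_within_continuous => t; rewrite in_itv/= => t01.
  by have [] := dgt _ t01.
exists t; first by move: t01; rewrite in_itv.
rewrite -[RHS]/(dg t) -[dg t]mulr1 -[in RHS](subr0 1) -gE /g /a.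
by rewrite scale1r scale0r addr0 [y + _]addrC subrK !mxE.
Qed.

(** Mean values are taken on the segment from [y] to [x], which stays in the ball by convexity; [m]
    terms are summed, hence the divisor [m%:R + 1]. *)
Lemma C1_sdiff m n (F : 'rV[R]_m -> 'rV[R]_n) u r : 0 < r ->
  (forall x, `|x - u| < r -> differentiable F x) ->
  {for u, continuous (jacobian F)} -> sdiff F u (jacobian F u).
Proof.
move=> r0 dF cF e e0; pose c : R := m%:R + 1.
have c0 : 0 < c by rewrite ltr_pwDr.
have /cvgrPdist_lt/(_ _ (divr_gt0 e0 c0))/nbhs_ballP[d /= d0 H] := cF.
exists (Num.min r d) => [|x y]; first by rewrite lt_min r0.
rewrite !lt_min => /andP[x1 x2] /andP[y1 y2].
have seg (t k : R) : 0 <= t <= 1 -> `|x - u| < k -> `|y - u| < k ->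
    `|y + t *: (x - y) - u| < k.
  move=> /andP[t0 t1] xk yk.
  have -> : y + t *: (x - y) - u = (1 - t) *: (y - u) + t *: (x - u) by mxabel.
  rewrite (le_lt_trans (ler_normD _ _))// !normrZ !ger0_norm ?subr_ge0//.
  have [->|t00] := eqVneq t 0; first by rewrite mul0r addr0 subr0 mul1r.
  have t00' : 0 < t by rewrite lt0r t00.
  have : t * `|x - u| < t * k by rewrite ltr_pM2l.
  have : (1 - t) * `|y - u| <= (1 - t) * k by rewrite ler_wpM2l ?subr_ge0// ltW.
  by lra.
apply: normr_le_entries => [|i j]; first by rewrite mulr_ge0// ltW.
rewrite [i]ord1.
have [t t01] := @mean_value_rV _ _ F x y j (fun t t01 => dF _ (seg _ _ t01 x1 y1)).
rewrite !mxE => ->.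
rewrite -!sumrB (le_trans (ler_norm_sum _ _ _))//.
apply: (@le_trans _ _ (\sum_(k < m) (`|x - y| * (e / c)))).
  apply: ler_sum => k _; rewrite -mulrBr normrM ler_pM ?normr_entry//.
  have := H (y + t *: (x - y)); rewrite -ball_normE /= distrC => /(_ (seg _ _ t01 x2 y2)).
  move/ltW; apply: le_trans.
  rewrite distrC; have := normr_entry (jacobian F u - jacobian F (y + t *: (x - y))) k j.
  by rewrite [X in `|X| <= _ -> _]mxE [X in `|_ + X| <= _ -> _]mxE.
rewrite sumr_const card_ord -[leLHS]mulr_natl.
have -> : m%:R * (`|x - y| * (e / c)) = e * `|x - y| * (m%:R / c) by ring.
by rewrite ler_piMr ?mulr_ge0 ?(ltW e0)// ler_pdivrMr// mul1r /c lerDl.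
Qed.

End bridge.

(** * Uniform estimates from compactness *)

Section compact_support.
Context {R : realType}.
Implicit Types (m n : nat).

(** Each point gives a threshold for [d] that works nearby; compactness, as near covering with the
    right neighborhoods of 0, makes it uniform. *)
Lemma compact_uniform (T : topologicalType) (A : set T) (P : R -> T -> Prop) :
  compact A -> (forall d d' x, 0 < d' -> d' <= d -> P d x -> P d' x) ->
  (forall x, A x -> exists2 d, 0 < d & \forall x' \near x, P d x') ->
  exists2 d, 0 < d & forall x, A x -> P d x.
Proof.
move=> /compact_near_coveringP cA mP HP.
have : \forall d \near (0 : R)^'+, A `<=` P d.
  apply: cA => x /HP[d d0 Pd].
  exists ([set x' | P d x'], [set e | 0 < e /\ e <= d]) => /= [|[x' e] /= [Px' [e0 ed]]].
    split=> //=; near=> e; split; near: e; [exact: nbhs_right_gt|exact: nbhs_right_le].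
  exact: mP e0 ed Px'.
move=> H; near (0 : R)^'+ => d; exists d; near: d => //; exact: nbhs_right_gt.
Unshelve. all: by end_near. Qed.

Lemma compact_norm_ball n (r : R) : compact [set x : 'rV[R]_n | `|x| <= r].
Proof.
apply: bounded_closed_compact.
  by exists r; split=> [|M rM x /= xr]; rewrite ?num_real// (le_trans xr)// ltW.
have -> : [set x : 'rV[R]_n | `|x| <= r] = Num.norm @^-1` [set y | y <= r] by [].
by apply: closed_comp => // x _; exact: norm_continuous.
Qed.

Lemma nbhs_norm_lt n (u : 'rV[R]_n) d : 0 < d -> \forall x \near u, `|x - u| < d.
Proof.
move=> d0; apply/nbhs_ballP; exists d => //= x; rewrite -ball_normE /=.
by rewrite distrC.
Qed.

Section support.
Context {m n : nat} (F : 'rV[R]_m -> 'rV[R]_n) (r : R).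
Context (F0 : forall x, r <= `|x| -> F x = 0).
Context (dF : forall u, exists M, sdiff F u M).

Lemma compact_support_lipschitz :
  exists2 L : R, 0 < L & forall x y, `|F x - F y| <= L * `|x - y|.
Proof.
(* One [d] is both the radius and the inverse of the Lipschitz constant, so that shrinking it only
   weakens the claim, as [compact_uniform] asks. *)
have [d d0 H] : exists2 d : R, 0 < d & forall x, `|x| <= r ->
    forall y, `|y - x| < d -> `|F x - F y| <= d^-1 * `|x - y|.
  apply: (compact_uniform (P := fun d x => forall y, `|y - x| < d ->
    `|F x - F y| <= d^-1 * `|x - y|) (@compact_norm_ball m r)) => [d d' x d'0 dd' H y yx|u _].
    rewrite (le_trans (H _ (lt_le_trans yx dd')))// ler_wpM2r//.
    by rewrite lef_pV2// posrE (lt_le_trans d'0).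
  have [M /sdiff_lipschitz[d d0 H]] := dF u; set K := _ + 1 in H.
  have K0 : 0 < K by rewrite ltr_pwDr ?mxnorm1_ge0.
  exists (Num.min (d / 2) K^-1); first by rewrite lt_min invr_gt0 K0 divr_gt0.
  near=> x => y; rewrite lt_min => /andP[yx _].
  have xu : `|x - u| < d / 2 by near: x; apply: nbhs_norm_lt; rewrite divr_gt0.
  have xd : `|x - u| < d by lra.
  have yd : `|y - u| < d.
    have -> : y - u = (y - x) + (x - u) by rewrite addrA subrK.
    by rewrite (le_lt_trans (ler_normD _ _))// [ltRHS]splitr ltrD.
  rewrite (le_trans (H _ _ xd yd))// ler_wpM2r// -[leLHS]invrK lef_pV2 ?posrE ?invr_gt0//.
    by rewrite ge_min lexx orbT.
  by rewrite lt_min invr_gt0 K0 divr_gt0.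
have [b b0 Fb] : exists2 d : R, 0 < d & forall x, `|x| <= r -> `|F x| <= d^-1.
  apply: (compact_uniform (P := fun d x => `|F x| <= d^-1)
    (@compact_norm_ball m r)) => [c c' x c'0 cc' Hc|u _].
    by rewrite (le_trans Hc)// lef_pV2// posrE (lt_le_trans c'0).
  have [M /sdiff_continuous/(_ ltr01)[e e0 He]] := dF u.
  have u0 : 0 < `|F u| + 1 by rewrite ltr_wpDl.
  exists (`|F u| + 1)^-1; first by rewrite invr_gt0.
  near=> x; rewrite invrK -[F x](subrK (F u)) addrC (le_trans (ler_normD _ _))//.
  by rewrite lerD2l ltW// He//; near: x; exact: nbhs_norm_lt.
have {}Fb x : `|F x| <= b^-1.
  by have [/ltW/Fb//|/F0 ->] := ltP `|x| r; rewrite normr0 invr_ge0 ltW.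
have [iv jv] : 0 < d^-1 /\ 0 < b^-1 by rewrite !invr_gt0.
exists (d^-1 + 2 * b^-1 / d) => [|x y].
  by rewrite addr_gt0// divr_gt0// mulr_gt0.
(* At distance at least [d], the bound [b^-1] of |F| suffices. *)
have [xy|xy] := ltP `|x - y| d; last first.
  rewrite mulrDl (@le_trans _ _ (2 * b^-1 / d * `|x - y|))//; last first.
    by rewrite lerDr mulr_ge0// ltW.
  apply: (@le_trans _ _ (2 * b^-1)).
    by rewrite (le_trans (ler_normB _ _))// mulr_natl mulr2n lerD.
  rewrite -mulrA ler_peMr ?mulr_ge0 ?(ltW jv)//.
  by rewrite ler_pdivlMl// mulr1.
apply: (@le_trans _ _ (d^-1 * `|x - y|)); last first.
  by rewrite ler_wpM2r// lerDl ltW// divr_gt0// mulr_gt0.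
have [xr|xr] := leP `|x| r; first by apply: H => //; rewrite distrC.
have [yr|yr] := leP `|y| r; first by rewrite distrC [`|x - y|]distrC; apply: H.
by rewrite !F0 ?subrr ?normr0 ?mulr_ge0 ?(ltW iv)// ltW.
Unshelve. all: by end_near. Qed.

(** Uniform continuity of the derivative, stated without it: a small translation changes [F] by a
    map of small Lipschitz constant. *)
Lemma compact_support_second_difference e : 0 < e ->
  exists2 d : R, 0 < d & forall x y v, `|v| < d ->
    `|(F (x + v) - F x) - (F (y + v) - F y)| <= e * `|x - y|.
Proof.
move=> e0.
pose P d x := forall y v, `|y - x| < d -> `|v| < d ->
  `|(F (x + v) - F x) - (F (y + v) - F y)| <= e * `|x - y|.
(* The radius [r + 1] leaves room for |v| < 1: beyond it, both [x] and [x + v] are outside the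
   support. *)
have [d d0 H] : exists2 d : R, 0 < d & forall x, `|x| <= r + 1 -> P d x.
  apply: (compact_uniform (@compact_norm_ball m (r + 1))) => [d d' x _ dd' H y v yx vd|u _].
    by apply: H; exact: lt_le_trans dd'.
  have [M dM] := dF u; have [d d0 H] := dM _ (divr_gt0 e0 (ltr0n _ 2)).
  exists (d / 3); first by rewrite divr_gt0.
  near=> x => y v yx vd.
  have xu : `|x - u| < d / 3 by near: x; apply: nbhs_norm_lt; rewrite divr_gt0.
  have yu : `|y - u| < d / 3 * 2.
    have -> : y - u = (y - x) + (x - u) by rewrite addrA subrK.
    by rewrite (le_lt_trans (ler_normD _ _))// mulr_natr mulr2n ltrD.
  have xvu : `|x + v - u| < d.
    by rewrite addrAC (le_lt_trans (ler_normD _ _))//; lra.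
  have yvu : `|y + v - u| < d.
    by rewrite addrAC (le_lt_trans (ler_normD _ _))//; lra.
  have H1 := H _ _ xvu yvu; have H2 : `|F x - F y - (x - y) *m M| <= e / 2 * `|x - y|.
    by apply: H; lra.
  have E : x + v - (y + v) = x - y by rewrite opprD addrACA subrr addr0.
  rewrite E in H1.
  have -> : F (x + v) - F x - (F (y + v) - F y) =
     (F (x + v) - F (y + v) - (x - y) *m M) - (F x - F y - (x - y) *m M) by mxabel.
  by rewrite (le_trans (ler_normB _ _))// [e]splitr mulrDl lerD.
have [L L0 FL] := compact_support_lipschitz.
(* For |x - y| >= d, twice the Lipschitz bound L |v| has to be at most e d. *)
exists (Num.min (Num.min d 1) (e * d / (L * 2))) => [|x y v].
  by rewrite !lt_min d0 ltr01/= divr_gt0 ?mulr_gt0.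
rewrite !lt_min => /andP[/andP[vd v1] ve].
have [xy|xy] := ltP `|x - y| d; last first.
  apply: (@le_trans _ _ (e * d)); last by rewrite ler_pM2l.
  rewrite ltr_pdivlMr ?mulr_gt0// in ve.
  have := FL (x + v) x; have := FL (y + v) y.
  rewrite ![_ + v]addrC !addrK => F1 F2.
  by rewrite (le_trans (ler_normB _ _))//; lra.
have [xr|xr] := leP `|x| (r + 1); first by apply: H => //; rewrite distrC.
have [yr|yr] := leP `|y| (r + 1).
  by rewrite distrC [`|x - y|]distrC; apply: H.
have far z : r + 1 < `|z| -> F (z + v) - F z = 0.
  move=> zr; have := lerB_dist z (- v); rewrite opprK normrN => K.
  by rewrite !F0 ?subrr//; lra.
by rewrite !far// subrr normr0 mulr_ge0// ltW.
Unshelve. all: by end_near. Qed.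

End support.

Lemma sdiff_expanding n (F : 'rV[R]_n -> 'rV[R]_n) u M : M \in unitmx -> sdiff F u M ->
  exists2 d : R, 0 < d & forall x y, `|x - u| < d -> `|y - u| < d ->
    `|x - y| <= d^-1 * `|F x - F y|.
Proof.
move=> uM dF; pose k := mxnorm1 (invmx M) + 1.
have k0 : 0 < k by rewrite ltr_pwDr ?mxnorm1_ge0.
have [d d0 H] := dF _ (divr_gt0 ltr01 (mulr_gt0 k0 (ltr0n _ 2))).
have m0 : 0 < Num.min d (k * 2)^-1 by rewrite lt_min d0 invr_gt0 mulr_gt0.
exists (Num.min d (k * 2)^-1) => // x y; rewrite !lt_min => /andP[xu _] /andP[yu _].
have {}H := H _ _ xu yu.
have h1 : `|x - y| <= k * `|(x - y) *m M|.
  by rewrite (le_trans (normr_unitmx _ uM))// ler_wpM2r// lerDl.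
have h2 : `|(x - y) *m M| <= `|F x - F y| + `|F x - F y - (x - y) *m M|.
  have E : (x - y) *m M = (F x - F y) - (F x - F y - (x - y) *m M) by mxabel.
  by rewrite [X in `|X| <= _]E ler_normB.
have : `|x - y| <= k * 2 * `|F x - F y|.
  have : k * `|(x - y) *m M| <= k * (`|F x - F y| + 1 / (k * 2) * `|x - y|).
    by rewrite ler_pM2l// (le_trans h2)// lerD2l.
  have -> : k * (`|F x - F y| + 1 / (k * 2) * `|x - y|) = k * `|F x - F y| + `|x - y| / 2.
    by field; rewrite gt_eqF.
  by lra.
move/le_trans; apply; rewrite ler_wpM2r//.
by rewrite -[leLHS]invrK lef_pV2 ?posrE ?invr_gt0 ?mulr_gt0// ge_min lexx orbT.
Qed.

(** Makes the inverse Lipschitz without an inverse function theorem. On a compact set of pairs,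
    invertible derivatives handle the diagonal and injectivity the rest. *)
Lemma compact_support_expanding n (q : 'rV[R]_n -> 'rV[R]_n) (r : R) : 0 < r ->
  injective q -> (forall x, r <= `|x| -> q x = x) ->
  (forall u, exists2 M, M \in unitmx & sdiff q u M) ->
  exists2 L : R, 0 < L & forall x y, `|x - y| <= L * `|q x - q y|.
Proof.
move=> r0 qI q1 dq.
pose K := [set x : 'rV[R]_n | `|x| <= r + 1].
have cK : compact (K `*` K) by apply: compact_setX; exact: compact_norm_ball.
pose P d (z : 'rV[R]_n * 'rV[R]_n) := `|z.1 - z.2| <= d^-1 * `|q z.1 - q z.2|.
have [d d0 H] : exists2 d : R, 0 < d & forall z, (K `*` K) z -> P d z.
  apply: (compact_uniform (P := P) cK) => [d d' x d'0 dd'|].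
    have d0 := lt_le_trans d'0 dd'.
    by move/le_trans; apply; rewrite ler_wpM2r// lef_pV2.
  move=> [u u'] _.
  have [<-|uu'] := eqVneq u u'.
    have [M uM /(sdiff_expanding uM)[d d0 H]] := dq u; exists d => //.
    exists ([set x | `|x - u| < d], [set x | `|x - u| < d]).
      by split; exact: nbhs_norm_lt.
    by move=> [x y] /= [xu yu]; exact: H.
  (* Off the diagonal each image moves by less than a quarter of |q u - q u'|, so the images stay
     half that distance apart. *)
  have quu' : 0 < `|q u - q u'| by rewrite normr_gt0 subr_eq0 (inj_eq qI).
  have q4 : 0 < `|q u - q u'| / 4 by rewrite divr_gt0.
  have [M _ /sdiff_continuous/(_ q4)[d d0 H]] := dq u.
  have [M' _ /sdiff_continuous/(_ q4)[d' d'0 H']] := dq u'.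
  have B0 : 0 < `|u - u'| + d + d' by rewrite addr_gt0// ltr_wpDl.
  exists (`|q u - q u'| / 2 / (`|u - u'| + d + d')); first by rewrite !divr_gt0.
  exists ([set x | `|x - u| < d], [set x | `|x - u'| < d']).
    by split; exact: nbhs_norm_lt.
  move=> [x y] /= [xu yu]; rewrite /P /=.
  have xy : `|x - y| <= `|u - u'| + d + d'.
    have -> : x - y = (u - u') + (x - u) - (y - u') by mxabel.
    by rewrite (le_trans (ler_normB _ _))// lerD ?(ltW yu)// (le_trans (ler_normD _ _))// lerD2l ltW.
  rewrite (le_trans xy)// invf_div -mulrA ler_peMr ?(ltW B0)//.
  rewrite ler_pdivlMl ?divr_gt0// mulr1.
  have : `|q u - q u'| <= `|q x - q y| + `|q x - q u| + `|q y - q u'|.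
    have -> : q u - q u' = (q x - q y) - (q x - q u) + (q y - q u') by mxabel.
    by rewrite (le_trans (ler_normD _ _))// lerD2r ler_normB.
  by have := H _ xu; have := H' _ yu; lra.
have qr x : `|x| < r -> `|q x| < r.
  move=> xr; rewrite ltNge; apply/negP => qxr; have /qI qx := q1 _ qxr.
  by move: xr; rewrite ltNge -{1}qx qxr.
(* If |a| < r and |b| > r + 1, then |a - b| <= |b| + r <= (1 + 2 r) (|b| - r), and [q] keeps [a] in
   the ball. *)
pose L := 1 + 2 * r + d^-1; have L1 : 1 <= L by rewrite /L -addrA lerDl addr_ge0 ?mulr_ge0 ?invr_ge0 ?ltW.
have Ld : d^-1 <= L by rewrite /L lerDr addr_ge0 ?mulr_ge0 ?(ltW r0).
exists L => [|x y]; first exact: lt_le_trans L1.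
have mixed a b : `|a| <= r + 1 -> r + 1 < `|b| -> `|a - b| <= L * `|q a - q b|.
  move=> ar br; rewrite (q1 b); last by lra.
  have [/q1 ->|{}ar] := leP r `|a|; first by rewrite ler_peMl.
  have k1 : `|b| - r <= `|q a - b|.
    have := lerB_dist b (q a); rewrite [`|b - _|]distrC; have := qr _ ar; lra.
  apply: (@le_trans _ _ ((1 + 2 * r) * `|q a - b|)); last first.
    by rewrite ler_wpM2r// /L lerDl invr_ge0 ltW.
  apply: (@le_trans _ _ ((1 + 2 * r) * (`|b| - r))); last first.
    by rewrite ler_wpM2l// addr_ge0 ?mulr_ge0 ?(ltW r0).
  by have := ler_normB a b; nra.
have [xr|xr] := leP `|x| (r + 1); have [yr|yr] := leP `|y| (r + 1).
- by have /le_trans := H (x, y) (conj xr yr); apply; rewrite ler_wpM2r.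
- exact: mixed.
- by rewrite distrC [`|q x - _|]distrC; exact: mixed.
- by rewrite !q1 ?ler_peMl//; lra.
Qed.

End compact_support.

(** * Paths of homeomorphisms of the sphere *)

Section sphere_derivative.
Context {R : realType} {n : nat}.
Implicit Types (F G : sphere R n -> sphere R n) (u v : 'rV[R]_n).

(** [affine_part] reads infinity as 0, hence the clause on finiteness near [u]. *)
Definition sphere_diff F u M :=
  (exists2 d : R, 0 < d & forall x, `|x - u| < d -> F (Some x) <> None) /\
  sdiff (affine_part F) u M.

Lemma Some_affine_part F u : F (Some u) <> None -> F (Some u) = Some (affine_part F u).
Proof. by rewrite /affine_part; case: (F (Some u)). Qed.

Lemma sphere_diff_finite F u M : sphere_diff F u M -> F (Some u) <> None.
Proof. by move=> [[d d0 H] _]; apply: H; rewrite subrr normr0. Qed.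

Lemma sphere_diff_near F G u M r : 0 < r ->
  (forall x, `|x - u| < r -> F (Some x) = G (Some x)) ->
  sphere_diff F u M -> sphere_diff G u M.
Proof.
move=> r0 FG [[d d0 H] dF]; split.
  exists (Num.min r d) => [|x]; first by rewrite lt_min r0.
  by rewrite lt_min => /andP[/FG <- /H].
by apply: sdiff_near r0 _ dF => x /FG; rewrite /affine_part => ->.
Qed.

Lemma sphere_diff_comp F G u v M N : F (Some u) = Some v ->
  sphere_diff F u M -> sphere_diff G v N -> sphere_diff (G \o F) u (M *m N).
Proof.
move=> Fu [[d d0 Fd] dF] [[e e0 Ge] dG].
have vE : v = affine_part F u by rewrite /affine_part Fu.
have [d' d'0 Fc] := sdiff_continuous dF e0.
split.
  exists (Num.min d d') => [|x]; first by rewrite lt_min d0.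
  rewrite lt_min => /andP[xd xd'] /=; rewrite (Some_affine_part (Fd _ xd)).
  by apply: Ge; rewrite vE Fc.
have := sdiff_comp dF (F := affine_part F) (G := affine_part G) (B := N).
rewrite -vE => /(_ dG); apply: sdiff_near d0 _ => x /Fd /Some_affine_part.
by move=> Fx; rewrite {3}/affine_part /= Fx.
Qed.

Lemma sphere_diff_unit F G u v M N : F (Some u) = Some v -> cancel F G ->
  sphere_diff F u M -> sphere_diff G v N -> M \in unitmx.
Proof.
move=> Fu FK dF dG; have [_ d1] := sphere_diff_comp Fu dF dG.
have : sdiff (affine_part (G \o F)) u 1%:M.
  apply: sdiff_near ltr01 _ (sdiff_id u) => x _.
  by rewrite /affine_part /= FK.
by move=> /(sdiff_uniq d1)/mulmx1_unit[].
Qed.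

End sphere_derivative.

(** * Isotopies to the identity and their composition *)

Section isotopy.
Context {R : realType} {n : nat}.
Local Notation S := (sphere R n).
Implicit Types (F G H : S -> S) (h g : R -> S -> S).

(* The inverse-free form of [bilipschitz_path]: [F o G^-1] is within [e] of the
   identity and expands distances by a factor at most [1 + e]. *)
Definition close (e : R) F G :=
  (forall p, mdist (F p) (G p) < e) /\
  (forall p q, mdist (F p) (F q) <= (1 + e) * mdist (G p) (G q)).

Definition close_path h := forall e : R, 0 < e -> exists2 d : R, 0 < d &
  forall s t : R, 0 <= s <= 1 -> 0 <= t <= 1 -> `|s - t| < d -> close e (h s) (h t).

(** Finite exceptional sets are null in positive dimension, stable under composition with
    bijections, and leave room for points that the inverted chart sends to infinity. *)
Definition oriented_off_finite F := exists s : seq S, forall u : 'rV[R]_n,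
  (Some u : S) \notin s -> exists2 M, sphere_diff F u M & 0 < \det M.

Definition isotopic_to_id F := exists h,
  [/\ h 0 =1 id, h 1 =1 F, forall t, 0 <= t <= 1 -> bijective (h t),
      forall t, 0 <= t <= 1 -> oriented_off_finite (h t) & close_path h].

(** As the step length [d] is uniform, finitely many steps of length t / (N + 1) < d reach [t] from
    0. *)
Lemma unit_interval_chain (P : R -> Prop) : P 0 ->
  (exists2 d : R, 0 < d & forall s t : R, 0 <= s <= 1 -> 0 <= t <= 1 ->
     `|s - t| < d -> P t -> P s) ->
  forall t : R, 0 <= t <= 1 -> P t.
Proof.
move=> P0 [d d0 Pd] t /andP[t0 t1].
have [N Nd] : exists N : nat, d^-1 < N.+1%:R.
  by exists (Num.trunc d^-1); rewrite truncnS_gt.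
suff H k : (k <= N.+1)%N -> P (t * k%:R / N.+1%:R).
  by have := H N.+1 (leqnn _); rewrite mulfK// pnatr_eq0.
have in01 j : (j <= N.+1)%N -> 0 <= t * j%:R / N.+1%:R <= 1.
  move=> jN; rewrite divr_ge0 ?mulr_ge0//= ler_pdivrMr// mul1r.
  by rewrite (@le_trans _ _ j%:R) ?ler_piMl ?ler_nat.
elim: k => [|k IH] kN; first by rewrite mulr0 mul0r.
apply: (Pd _ (t * k%:R / N.+1%:R)); rewrite ?in01 ?(ltnW kN)//; last exact: IH (ltnW kN).
rewrite -mulrBl -mulrBr -natrB// subSnn mulr1 ger0_norm ?divr_ge0//.
rewrite ltr_pdivrMr// (le_lt_trans t1)// -ltr_pdivrMl// mulr1//.
Qed.

(** With tolerance 1, a short step along the path at most doubles the bi-Lipschitz constant. *)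
Lemma close_path_bilipschitz h t : h 0 =1 id -> close_path h -> 0 <= t <= 1 ->
  exists2 L : R, 1 <= L & bilipschitz L (h t).
Proof.
move=> h0 hP; move: t; apply: unit_interval_chain.
  by exists 1 => // x y; rewrite !h0 divr1 mul1r.
have [d d0 H] := hP _ ltr01; exists d => // s t s01 t01 st [L L1 hL].
exists (2 * L) => [|x y]; first by rewrite (le_trans L1)// ler_peMl ?ler1n// (le_trans ler01).
have L0 : 0 < L by rewrite (lt_le_trans ltr01).
have [_ /(_ x y) k1] := H _ _ s01 t01 st.
have [_ /(_ x y) k2] : close 1 (h t) (h s) by apply: H => //; rewrite distrC.
have [k3 k4] := hL x y; split; last by rewrite (le_trans k1)// -mulrA ler_wpM2l.
rewrite ler_pdivrMr ?mulr_gt0//.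
rewrite ler_pdivrMr// in k3; rewrite (le_trans k3)//.
by rewrite [leRHS]mulrA ler_pM2r// mulrC.
Qed.

Lemma finite_lebesgue_null (s : seq S) : (0 < n)%N ->
  lebesgue_null [set u : 'rV[R]_n | (Some u : S) \in s].
Proof.
move=> n0 e e0; exists (fun k => odflt 0 (nth None s k)), (fun=> 0); split=> //.
  move=> u /= us; exists (index (Some u : S) s) => //=.
  by rewrite nth_index//= subrr normr0.
by move=> m; rewrite big1 ?ltW// => i _; rewrite mulr0 expr0n; case: n n0.
Qed.

Lemma oriented_off_finite_orientation_preserving F : (0 < n)%N ->
  oriented_off_finite F -> orientation_preserving F.
Proof.
move=> n0 [s Fs] e e0; have [c [r [r0 cr sr]]] := finite_lebesgue_null s n0 e0.
exists c, r; split=> //; apply: subset_trans cr => u /= nFu.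
apply/negPn/negP => /Fs[M dF M0]; apply: nFu.
have [_ /sdiff_differentiable[d1 d2]] := dF; split=> //.
  exact: sphere_diff_finite dF.
by rewrite d2.
Qed.

Lemma isotopic_to_id_path F : (0 < n)%N -> isotopic_to_id F ->
  exists A : R -> LIP (sphere R n),
    [/\ sphere_bilipschitz_path A, A 0 =1 id & A 1 =1 F].
Proof.
move=> n0 [h [h0 h1 hb ho hP]].
have idL : exists2 L : R, 1 <= L & bilipschitz L (@id S).
  by exists 1 => // x y; rewrite divr1 mul1r.
(* Default value of the path outside [0, 1]. *)
pose LIP_id := @Build_LIP _ S id id (fun=> erefl) (fun=> erefl) idL.
have /choice[A Ah] : forall t, exists p : LIP S, 0 <= t <= 1 -> p =1 h t.
  move=> t; have [t01|] := boolP (0 <= t <= 1); last by exists LIP_id.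
  have [g hK gK] := hb t t01.
  by exists (Build_LIP hK gK (close_path_bilipschitz h0 hP t01)).
have z01 : 0 <= (0 : R) <= 1 by rewrite lexx ler01.
have o01 : 0 <= (1 : R) <= 1 by rewrite lexx ler01.
exists A; split; last 2 first.
- by move=> x; rewrite Ah.
- by move=> x; rewrite Ah.
split; last first.
  move=> t t01; have -> : A t = h t :> (S -> S) by apply/funext/Ah.
  exact/oriented_off_finite_orientation_preserving/ho.
move=> e e0; have [d d0 H] := hP _ e0; exists d => // s t s01 t01 st.
have [H1 H2] := H _ _ s01 t01 st.
(* Exchanging [s] and [t] bounds the distances from below. *)
have [_ H3] : close e (h t) (h s) by apply: H => //; rewrite distrC.
have hAt y : h t (LIP_inv (A t) y) = y by rewrite -Ah// LIP_invK.
split=> [x|x y]; first by rewrite Ah// -{2}(hAt x).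
rewrite /= !Ah//; split; last by rewrite -{2}(hAt x) -{2}(hAt y).
rewrite ler_pdivrMr ?ltr_wpDl// mulrC -{1}(hAt x) -{1}(hAt y); exact: H3.
Qed.

Lemma isotopic_to_id_eq F G : F =1 G -> isotopic_to_id F -> isotopic_to_id G.
Proof. by move=> /funext <-. Qed.

(** For d <= 1, two expansions give (1 + d)^2 <= 1 + 3 d <= 1 + e. *)
Lemma close_trans e F G H : 0 < e -> close (Num.min e 1 / 3) F G ->
  close (Num.min e 1 / 3) G H -> close e F H.
Proof.
move=> e0; set d := Num.min e 1 / 3.
have d0 : 0 < d by rewrite divr_gt0// lt_min e0 ltr01.
have [de d1] : d * 3 <= e /\ d * 3 <= 1.
  by rewrite /d mulfVK//; split; rewrite ge_min lexx ?orbT.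
move=> [a1 a2] [b1 b2]; split=> [p|p q].
  rewrite (le_lt_trans (metric_triangle _ (G p) _))//.
  by have := a1 p; have := b1 p; lra.
rewrite (le_trans (a2 p q))//.
apply: (@le_trans _ _ ((1 + d) * ((1 + d) * mdist (H p) (H q)))).
  by rewrite ler_wpM2l// addr_ge0// ltW.
by rewrite mulrA ler_wpM2r ?mdist_ge0//; nra.
Qed.

Lemma close_le e e' F G : e' <= e -> close e' F G -> close e F G.
Proof.
move=> ee [a b]; split=> [p|p q]; first exact: lt_le_trans (a p) ee.
by rewrite (le_trans (b p q))// ler_wpM2r ?mdist_ge0// lerD2l.
Qed.

Lemma isotopic_to_id_comp F G :
  isotopic_to_id F -> isotopic_to_id G -> isotopic_to_id (G \o F).
Proof.
move=> [h [h0 h1 hb ho hP]] [g [g0 g1 gb go gP]].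
pose k (t : R) : S -> S := if t <= 2^-1 then h (2 * t) else g (2 * t - 1) \o h 1.
have kh t : t <= 2^-1 -> k t = h (2 * t) by rewrite /k => ->.
have kg t : 2^-1 <= t -> k t = g (2 * t - 1) \o h 1.
  move=> t2; rewrite /k; case: ltgtP t2 => // <- _.
  by rewrite mulfV ?pnatr_eq0// subrr; apply/funext => p /=; rewrite g0.
have o01 : 0 <= (1 : R) <= 1 by rewrite lexx ler01.
have kcase t : 0 <= t <= 1 -> (0 <= 2 * t <= 1 /\ k t = h (2 * t)) \/
     (0 <= 2 * t - 1 <= 1 /\ k t = g (2 * t - 1) \o h 1).
  move=> /andP[t0 t1]; have [t2|/ltW t2] := leP t 2^-1.
    by left; rewrite kh//; split=> //; apply/andP; split; lra.
  by right; rewrite kg//; split=> //; apply/andP; split; lra.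
exists k; split.
- by move=> p; rewrite kh ?invr_ge0// mulr0 h0.
- move=> p; rewrite kg ?invf_le1 ?ler1n//= mulr1.
  have -> : 2 - 1 = 1 :> R by lra.
  by rewrite g1 h1.
- move=> t /kcase[[t2 ->]|[t2 ->]]; first exact: hb.
  by apply: bij_comp; [exact: gb|exact: hb].
- move=> t /kcase[[t2 ->]|[t2 ->]]; first exact: ho.
  have [s hs] := ho _ o01; have [s' gs'] := go _ t2.
  have [h1' hK h'K] := hb _ o01.
  (* Excluded are the bad points of [h 1] and the preimages under [h 1] of the bad points of the
     second path. *)
  exists (s ++ [seq h1' p | p <- s']) => u; rewrite mem_cat negb_or => /andP[/hs[M dM M0] us'].
  have hu := Some_affine_part (sphere_diff_finite dM).
  have [|N dN N0] := gs' (affine_part (h 1) u).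
    by apply: contra us' => us'; rewrite -[Some u]hK hu map_f.
  exists (M *m N); first exact: sphere_diff_comp hu dM dN.
  by rewrite det_mulmx mulr_gt0.
move=> e e0; pose c := Num.min e 1 / 3.
have c0 : 0 < c by rewrite divr_gt0// lt_min e0 ltr01.
have ce : c <= e.
  by rewrite ler_pdivrMr// ge_min; apply/orP; left; lra.
have [dh dh0 Hh] := hP _ c0; have [dg dg0 Hg] := gP _ c0.
pose d := Num.min dh dg / 2.
have ddh : d * 2 <= dh by rewrite mulfVK// ge_min lexx.
have ddg : d * 2 <= dg by rewrite mulfVK// ge_min lexx orbT.
have low s t : 0 <= s <= 2^-1 -> 0 <= t <= 2^-1 -> `|s - t| < d -> close c (k s) (k t).
  move=> /andP[s0 s2] /andP[t0 t2] st; rewrite !kh//; apply: Hh.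
  - by apply/andP; split; lra.
  - by apply/andP; split; lra.
  - by rewrite -mulrBr normrM ger0_norm//; lra.
(* Closeness survives composition on the right with [h 1], being a condition at all points. *)
have high s t : 2^-1 <= s <= 1 -> 2^-1 <= t <= 1 -> `|s - t| < d -> close c (k s) (k t).
  move=> /andP[s0 s2] /andP[t0 t2] st; rewrite !kg//.
  have [|||g1' g2'] := Hg (2 * s - 1) (2 * t - 1).
  - by apply/andP; split; lra.
  - by apply/andP; split; lra.
  - have -> : 2 * s - 1 - (2 * t - 1) = 2 * (s - t) by ring.
    by rewrite normrM ger0_norm//; lra.
  by split => *; [exact: g1'|exact: g2'].
exists d => [|s t /andP[s0 s1] /andP[t0 t1] st].
  by rewrite divr_gt0// lt_min dh0.
have [s2|/ltW s2] := leP s 2^-1; have [t2|/ltW t2] := leP t 2^-1.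
- by apply: close_le ce _; apply: low; rewrite ?s0 ?t0.
(* Times on different sides of 1/2 are compared through the middle. *)
- apply: (close_trans (G := k 2^-1)) => //.
    by apply: low; rewrite ?s0 ?lexx ?andbT ?invr_ge0//; move: st; rewrite !ltr_norml; lra.
  by apply: high; rewrite ?lexx ?t2 ?invf_le1 ?ler1n//; move: st; rewrite !ltr_norml; lra.
- apply: (close_trans (G := k 2^-1)) => //.
    by apply: high; rewrite ?lexx ?s2 ?invf_le1 ?ler1n//; move: st; rewrite !ltr_norml; lra.
  by apply: low; rewrite ?t0 ?lexx ?andbT ?invr_ge0//; move: st; rewrite !ltr_norml; lra.
- by apply: close_le ce _; apply: high; rewrite ?s2 ?t2.
Qed.

End isotopy.

(** * The inversion is an orientation reversing chordal isometry *)

Section inversion.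
Context {R : realType} {n : nat}.
Implicit Types (x y u : 'rV[R]_n) (p q : sphere R n).

Lemma enorm0 : enorm (0 : 'rV[R]_n) = 0.
Proof. by rewrite /enorm big1 ?sqrtr0// => i _; rewrite mxE expr0n. Qed.

Lemma enorm_eq0 x : (enorm x == 0) = (x == 0).
Proof. by apply/eqP/eqP => [/enorm0_eq0//|->]; exact: enorm0. Qed.

Lemma enormZ (a : R) x : enorm (a *: x) = `|a| * enorm x.
Proof.
apply/eqP; rewrite -(@eqrXn2 _ 2) ?mulr_ge0 ?enorm_ge0//.
by rewrite exprMn !sqr_enorm dotpZl dotpC dotpZl mulrA -expr2 real_normK ?num_real.
Qed.

Lemma dotp_mulmx x y : dotp x y = (x *m y^T) 0 0.
Proof. by rewrite mxE; apply: eq_bigr => i _; rewrite mxE. Qed.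

Lemma sqr_chordal_Some x y : chordal (Some x) (Some y) ^+ 2 =
  enorm (x - y) ^+ 2 / ((1 + enorm x ^+ 2) * (1 + enorm y ^+ 2)).
Proof.
have pos (z : 'rV[R]_n) : 0 <= 1 + enorm z ^+ 2 by rewrite addr_ge0 ?sqr_ge0.
by rewrite /= expr_div_n exprMn (sqr_sqrtr (pos x)) (sqr_sqrtr (pos y)). Qed.

Lemma sqr_chordal_None x : chordal (Some x) None ^+ 2 = 1 / (1 + enorm x ^+ 2).
Proof. by rewrite /= expr_div_n expr1n sqr_sqrtr// addr_ge0 ?sqr_ge0. Qed.

Lemma inversionK : involutive (@inversion R n).
Proof.
case=> [x|] /=; last by rewrite eqxx.
have [->|x0] := eqVneq x 0; first by [].
have e0 : enorm x != 0 by rewrite enorm_eq0.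
rewrite /= scaler_eq0 invr_eq0 sqrf_eq0 (negbTE e0) (negbTE x0) /= enormZ scalerA.
rewrite ger0_norm ?invr_ge0 ?sqr_ge0//; congr Some.
by rewrite [X in X *: _](_ : _ = 1) ?scale1r//; field.
Qed.

(** Under stereographic projection the inversion is the reflection that exchanges the poles. The
    computation compares squares, which are rational in |x|^2, |y|^2 and the dot product. *)
Lemma inversion_isometry p q : mdist (inversion p) (inversion q) = mdist p q.
Proof.
have pos x : 1 + enorm x ^+ 2 != 0 by rewrite gt_eqF// ltr_pwDl ?sqr_ge0.
have e00 : enorm (0 : 'rV[R]_n) ^+ 2 = 0 by rewrite enorm0 expr0n.
have I0 (x : 'rV[R]_n) : x != 0 -> enorm x ^+ 2 != 0 by move=> x0; rewrite sqrf_eq0 enorm_eq0.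
have IE (x : 'rV[R]_n) : x != 0 -> enorm ((enorm x ^+ 2)^-1 *: x) ^+ 2 = (enorm x ^+ 2)^-1.
  move=> x0; rewrite enormZ exprMn ger0_norm ?invr_ge0 ?sqr_ge0//.
  by field; rewrite enorm_eq0.
have dN (y : 'rV[R]_n) : enorm (0 - y) = enorm y by rewrite enormBC subr0.
have fld (X : R) : 1 + X != 0 -> X != 0 -> X^-1 / ((1 + X^-1) * (1 + 0)) = 1 / (1 + X).
  move=> Px Ix; have Px' : X + 1 != 0 by rewrite addrC.
  by rewrite addr0; field; rewrite ?Px ?Ix ?Px'.
have fld' (X : R) : 1 + X != 0 -> X != 0 -> 1 / (1 + X^-1) = X / ((1 + X) * (1 + 0)).
  move=> Px Ix; have Px' : X + 1 != 0 by rewrite addrC.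
  by rewrite addr0; field; rewrite ?Px ?Ix ?Px'.
have isoN x : mdist (inversion (Some x)) (inversion None) = mdist (Some x : sphere R n) None.
  apply/eqP; rewrite -(@eqrXn2 _ 2) ?mdist_ge0// !mdist_chordal; apply/eqP.
  rewrite sqr_chordal_None /=; have [->|x0] := eqVneq x 0.
    by rewrite -[chordal None (Some 0)]/(chordal (Some (0 : 'rV[R]_n)) None) sqr_chordal_None.
  by rewrite sqr_chordal_Some subr0 IE// e00; exact: fld (pos x) (I0 _ x0).
case: p q => [x|] [y|]; rewrite ?isoN//; last 2 first.
- by rewrite metric_sym isoN metric_sym.
- by rewrite !mdist_chordal /= subrr enorm0 mul0r.
apply/eqP; rewrite -(@eqrXn2 _ 2) ?mdist_ge0// !mdist_chordal; apply/eqP.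
rewrite [RHS]sqr_chordal_Some /=.
have [->|x0] := eqVneq x 0; have [->|y0] := eqVneq y 0.
- by rewrite subr0 e00 mul0r /= expr0n.
- rewrite -[chordal None _]/(chordal (Some ((enorm y ^+ 2)^-1 *: y)) None) sqr_chordal_None.
  by rewrite IE// dN e00 [_ * (1 + enorm y ^+ 2)]mulrC; exact: fld' (pos y) (I0 _ y0).
- by rewrite sqr_chordal_None IE// subr0 e00; exact: fld' (pos x) (I0 _ x0).
rewrite sqr_chordal_Some !IE// !sqr_enormB !IE// dotpZl dotpC dotpZl (dotpC y x).
have [Px Py] := (pos x, pos y); have [Ix Iy] := (I0 _ x0, I0 _ y0).
move: (enorm x ^+ 2) (enorm y ^+ 2) Px Py Ix Iy => X Y Px Py Ix Iy.
have [Px' Py'] : X + 1 != 0 /\ Y + 1 != 0 by rewrite ![_ + 1]addrC.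
by field; rewrite ?Px ?Py ?Ix ?Iy ?Px' ?Py'.
Qed.

(** The derivative is a^-1 times the reflection 1 - (2 / a) u^T u, with a = |u|^2, whose determinant
    is -1. *)
Lemma sphere_diff_inversion u : u != 0 ->
  exists2 M, sphere_diff (@inversion R n) u M & \det M < 0.
Proof.
move=> u0; pose a := enorm u ^+ 2.
have a0 : 0 < a by rewrite exprn_gt0// lt0r enorm_eq0 u0 enorm_ge0.
have aE : (u *m u^T) 0 0 = a by rewrite -dotp_mulmx -sqr_enorm.
have near0 x : `|x - u| < `|u| -> x != 0.
  by apply: contraTneq => ->; rewrite sub0r normrN ltxx.
have u0' : 0 < `|u| by rewrite normr_gt0.
have d1 : sdiff (fun x : 'rV[R]_n => ((x *m x^T) 0 0)^-1%:M : 'rV[R]_1) u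
    ((2 *: u^T) *m (- a ^- 2)%:M).
  have := sdiff_comp (sdiff_sqnorm u) (@sdiff_inv R (u *m u^T) _).
  by rewrite aE => /(_ a0).
have := sdiff_mul d1 (sdiff_id u).
rewrite [(_%:M) 0 0]mxE aE /= mulr1n.
set M := (X in sdiff _ _ X) => dM; exists M.
  split; first by exists `|u| => // x /near0 x0 /=; rewrite (negbTE x0).
  apply: sdiff_near u0' _ dM => x /near0 x0.
  rewrite /affine_part /= (negbTE x0) /= mul_scalar_mx.
  by rewrite -dotp_mulmx -sqr_enorm.
have -> : M = a^-1 *: (1%:M + (- 2 / a) *: u^T *m u).
  rewrite /M mul_mx_scalar scalerDr addrC; congr (_ + _).
  by rewrite -!scalemxAl !scalerA; congr (_ *: _); field; rewrite gt_eqF.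
rewrite detZ det_rank1_update -scalemxAr mxE aE mulfVK ?gt_eqF//.
by rewrite pmulr_rlt0 ?exprn_gt0 ?invr_gt0//; lra.
Qed.

End inversion.

(** * From Euclidean estimates to chordal paths *)

Section euclidean_paths.
Context {R : realType} {n : nat}.
Local Notation V := 'rV[R]_n.
Local Notation S := (sphere R n).

Definition extend (h : V -> V) (p : S) : S := if p is Some x then Some (h x) else None.

Lemma enorm_le_norm (x : V) : enorm x <= n%:R * `|x|.
Proof.
rewrite -(@ler_pXn2r _ 2) ?nnegrE ?mulr_ge0 ?enorm_ge0//.
rewrite sqr_enorm /dotp (@le_trans _ _ (\sum_(i < n) `|x| ^+ 2))//.
  apply: ler_sum => i _; rewrite -expr2 -real_normK ?num_real//.
  by rewrite ler_pXn2r ?nnegrE// normr_entry.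
rewrite sumr_const card_ord -[leLHS]mulr_natl exprMn ler_wpM2r ?sqr_ge0//.
by rewrite -natrX ler_nat; case: (n) => // m; rewrite leq_pmulr.
Qed.

Lemma norm_le_enorm (x : V) : `|x| <= enorm x.
Proof.
apply: normr_le_entries => [|i j]; first exact: enorm_ge0.
rewrite [i]ord1 -(@ler_pXn2r _ 2) ?nnegrE ?enorm_ge0// sqr_enorm real_normK ?num_real//.
by rewrite /dotp (bigD1 j)//= -expr2 lerDl sumr_ge0// => k _; rewrite -expr2 sqr_ge0.
Qed.

Let w (x : V) : R := Num.sqrt (1 + enorm x ^+ 2).

Let w2 x : w x ^+ 2 = 1 + enorm x ^+ 2.
Proof. by rewrite sqr_sqrtr// addr_ge0 ?sqr_ge0. Qed.

Let w1 x : 1 <= w x.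
Proof. by rewrite -(sqrtr1 R) ler_wsqrtr// lerDl sqr_ge0. Qed.

Let w_ge x : enorm x <= w x.
Proof.
by rewrite -(@ler_pXn2r _ 2) ?nnegrE ?enorm_ge0 ?sqrtr_ge0// w2 lerDr.
Qed.

Let w_dist x y : w x <= w y + enorm (x - y).
Proof.
have [wy dy] := (le_trans ler01 (w1 y), enorm_ge0 (x - y)).
rewrite -(@ler_pXn2r _ 2) ?nnegrE ?sqrtr_ge0 ?addr_ge0// w2 sqrrD w2.
have : enorm x <= enorm y + enorm (x - y) by rewrite addrC -{1}(subrK y x) enormD.
have := w_ge y; have := enorm_ge0 x; have := enorm_ge0 y.
by nra.
Qed.

(** Numerators of chordal distances grow by a factor at most 1 + d, and the weights [w] shrink by a
    factor at least 1 - 2 d; the 20 ensures 1 + d <= (1 + e) (1 - 2 d)^2. Displacements may grow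
    linearly, because the chordal metric shrinks at infinity. *)
Lemma extend_close (e : R) (h g : V -> V) : 0 < e ->
  let d := Num.min e 1 / 20 in
  (forall x, enorm (h x - g x) <= d * (1 + enorm (g x))) ->
  (forall x y, enorm ((h x - h y) - (g x - g y)) <= d * enorm (g x - g y)) ->
  close e (extend h) (extend g).
Proof.
move=> e0 d hg lip.
have d0 : 0 < d by rewrite divr_gt0// lt_min e0 ltr01.
have [de d1] : d * 20 <= e /\ d * 20 <= 1.
  by rewrite /d mulfVK//; split; rewrite ge_min lexx ?orbT.
have wh x : (1 - 2 * d) * w (g x) <= w (h x).
  have := w_dist (g x) (h x); rewrite enormBC; have := hg x.
  have := w1 (g x); have := w_ge (g x); nra.
have [W0 W0'] : (forall x, 0 < w (g x)) /\ (forall x, 0 < w (h x)).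
  by split=> x; rewrite (lt_le_trans ltr01).
have lipE x y : enorm (h x - h y) <= (1 + d) * enorm (g x - g y).
  have -> : h x - h y = ((h x - h y) - (g x - g y)) + (g x - g y) by rewrite subrK.
  by rewrite (le_trans (enormD _ _))// mulrDl mul1r addrC lerD2l lip.
have k0 : 0 < 1 - 2 * d by lra.
have ke : 1 + d <= (1 + e) * ((1 - 2 * d) * (1 - 2 * d)) by nra.
split=> [[x|]|[x|] [y|]]; rewrite !mdist_chordal /= -?/(w _).
- rewrite ltr_pdivrMr ?mulr_gt0// (le_lt_trans (hg x))//.
  apply: (@lt_le_trans _ _ (e * w (g x))).
    by have := w1 (g x); have := w_ge (g x); nra.
  by rewrite ler_pM2l// ler_peMl ?(ltW (W0 x)).
- by [].
- rewrite ler_pdivrMr ?mulr_gt0// -mulrA (le_trans (lipE x y))//.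
  apply: (@le_trans _ _ ((1 + e) * ((1 - 2 * d) * (1 - 2 * d)) * enorm (g x - g y))).
    by rewrite ler_wpM2r ?enorm_ge0.
  rewrite -mulrA ler_wpM2l ?addr_ge0 ?(ltW e0)// [leRHS]mulrAC ler_pdivlMr ?mulr_gt0//.
  rewrite [leLHS]mulrAC [leRHS]mulrC ler_wpM2r ?enorm_ge0// mulrACA.
  by rewrite ler_pM ?mulr_ge0 ?(ltW k0) ?(ltW (W0 _)).
- rewrite ler_pdivrMr// mul1r mulrAC ler_pdivlMr// mul1r.
  have := wh x; have := W0' x; have := W0 x; nra.
- rewrite ler_pdivrMr// mul1r mulrAC ler_pdivlMr// mul1r.
  have := wh y; have := W0' y; have := W0 y; nra.
- by rewrite mulr0.
Qed.

(** The second condition compares increments as vectors rather than their lengths; it thus controls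
    derivatives too, which gives the orientation. *)
Definition euclidean_path (h : R -> V -> V) := forall e : R, 0 < e ->
  exists2 d : R, 0 < d & forall s t : R, 0 <= s <= 1 -> 0 <= t <= 1 -> `|s - t| < d ->
    (forall x, `|h s x - h t x| <= e * (1 + `|h t x|)) /\
    (forall x y, `|(h s x - h s y) - (h t x - h t y)| <= e * `|h t x - h t y|).

Lemma euclidean_path_close h : euclidean_path h -> close_path (fun t => extend (h t)).
Proof.
move=> hP e e0; pose d := Num.min e 1 / 20.
have d0 : 0 < d by rewrite divr_gt0// lt_min e0 ltr01.
have n1 : 0 < n%:R + 1 :> R by rewrite ltr_wpDl.
(* Dividing by [n%:R + 1] pays for the passage from the sup norm to the Euclidean norm. *)
have [c c0 Hc] := hP _ (divr_gt0 d0 n1); exists c => // s t s01 t01 st.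
have [H1 H2] := Hc _ _ s01 t01 st.
have nE (x : V) (b : R) : 0 <= b -> `|x| <= d / (n%:R + 1) * b -> enorm x <= d * b.
  move=> b0 xb; rewrite (le_trans (enorm_le_norm _))//.
  rewrite (le_trans (ler_wpM2l _ xb))// mulrA ler_wpM2r//.
  by rewrite mulrCA ler_piMr ?(ltW d0)// ler_pdivrMr// mul1r lerDl.
apply: extend_close => // [x|x y]; apply: nE => //.
- by rewrite addr_ge0 ?enorm_ge0.
- rewrite (le_trans (H1 x))// ler_wpM2l ?(ltW (divr_gt0 d0 n1))//.
  by rewrite lerD2l norm_le_enorm.
- exact: enorm_ge0.
- rewrite (le_trans (H2 x y))// ler_wpM2l ?(ltW (divr_gt0 d0 n1))//.
  exact: norm_le_enorm.
Qed.

(** Scale [h] down until both remainders are at most a / c of its length, divide by the scale, and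
    let [a] tend to 0. *)
Lemma sdiff_norm_le (F G : V -> V) u A B (e : R) : 0 <= e ->
  sdiff F u A -> sdiff G u B -> (forall x, `|F x - F u| <= e * `|G x - G u|) ->
  forall h : V, `|h *m A| <= e * `|h *m B|.
Proof.
move=> e0 dF dG FG h; apply/ler_addgt0Pr => a a0.
pose c := (e + 1) * (`|h| + 1).
have h1 : 0 < `|h| + 1 by rewrite ltr_wpDl.
have e1 : 0 < e + 1 by rewrite ltr_wpDl.
have c0 : 0 < c by rewrite mulr_gt0.
have [d1 d10 H1] := dF _ (divr_gt0 a0 c0); have [d2 d20 H2] := dG _ (divr_gt0 a0 c0).
have m0 : 0 < Num.min d1 d2 by rewrite lt_min d10.
pose k := Num.min d1 d2 / (`|h| + 1).
have k0 : 0 < k by rewrite divr_gt0.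
have kh : `|k *: h| < Num.min d1 d2.
  rewrite normrZ gtr0_norm// /k mulrAC ltr_pdivrMr// ltr_pM2l// ltrDl//.
move: kh; rewrite lt_min => /andP[k1 k2].
have := H1 (u + k *: h) u; have := H2 (u + k *: h) u; have := FG (u + k *: h).
rewrite subrr normr0 addrAC subrr add0r -!scalemxAl.
move=> K /(_ k2 d20) K2 /(_ k1 d10) K1.
rewrite -(ler_pM2l k0) mulrDr mulrCA -{1 2}(gtr0_norm k0) -!normrZ.
have a1 : `|k *: (h *m A)| <= `|F (u + k *: h) - F u| + a / c * `|k *: h|.
  rewrite -lerBlDl (le_trans _ K1)// -[leRHS]normrN opprB.
  by rewrite lerB_dist.
have a2 : `|G (u + k *: h) - G u| <= `|k *: (h *m B)| + a / c * `|k *: h|.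
  by rewrite -lerBlDl (le_trans _ K2)// lerB_dist.
rewrite (le_trans a1)//.
apply: (@le_trans _ _ (e * (`|k *: (h *m B)| + a / c * `|k *: h|) + a / c * `|k *: h|)).
  by rewrite lerD2r (le_trans K)// ler_wpM2l.
rewrite mulrDr -addrA lerD2l -[X in _ + X]mul1r -mulrDl normrZ gtr0_norm//.
have -> : (e + 1) * (a / c * (k * `|h|)) = k * a * ((e + 1) * `|h| / c) by ring.
have : (e + 1) * `|h| / c <= 1 by rewrite ler_pdivrMr// mul1r ler_pM2l// lerDl.
by apply: ler_piMr; rewrite ltW// mulr_gt0.
Qed.

(* Nearby values of the path have derivatives that differ by a factor near [1]. *)
Lemma euclidean_path_det h : h 0 =1 id ->
  (forall t u, 0 <= t <= 1 -> exists M, sdiff (h t) u M) -> euclidean_path h ->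
  forall t : R, 0 <= t <= 1 -> forall u M, sdiff (h t) u M -> 0 < \det M.
Proof.
move=> h0 hd hP; apply: unit_interval_chain.
  move=> u M dM; have : sdiff (h 0) u 1%:M.
    by apply: sdiff_near ltr01 _ (sdiff_id u) => x _; rewrite h0.
  by move=> /(sdiff_uniq dM) ->; rewrite det1.
(* Tolerance 1/2 puts [invmx M *m N] within 1/2 of the identity. *)
have half : 0 < 2^-1 :> R by rewrite invr_gt0.
have [d d0 H] := hP _ half; exists d => // s t s01 t01 st IH u N dN.
have [M dM] := hd t u t01; have M0 := IH _ _ dM.
have uM : M \in unitmx by rewrite unitmxE unitfE gt_eqF.
have [_ H2] := H _ _ s01 t01 st.
have NM (v : V) : `|v *m (N - M)| <= 2^-1 * `|v *m M|.
  have -> : N - M = N + -1 *: M by rewrite scaleN1r.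
  apply: (sdiff_norm_le (ltW half) (sdiffD dN (sdiffZ (-1) dM)) dM) => x.
  rewrite !scaleN1r (le_trans _ (H2 x u))//.
  by rewrite [X in `|X| <= _](_ : _ = h s x - h s u - (h t x - h t u))//; mxabel.
have : 0 < \det (invmx M *m N).
  apply: (@det_near1_gt0 _ _ _ 2^-1) => [|z]; first by rewrite invf_lt1 ?ltr1n.
  have := NM (z *m invmx M); rewrite mulmxBr mulmxA.
  by rewrite -[z *m invmx M *m M]mulmxA mulVmx// mulmx1.
by rewrite det_mulmx det_inv pmulr_rgt0// invr_gt0.
Qed.

Lemma extend_bijective (h : V -> V) : bijective h -> bijective (extend h).
Proof.
move=> [g hK gK]; exists (extend g); case=> //= x; rewrite ?hK ?gK//.
Qed.

Lemma sphere_diff_extend (h : V -> V) u M : sdiff h u M -> sphere_diff (extend h) u M.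
Proof. by move=> dh; split; [exists 1|exact: dh]. Qed.

Lemma euclidean_isotopy (h : R -> V -> V) : h 0 =1 id ->
  (forall t, 0 <= t <= 1 -> bijective (h t)) ->
  (forall t u, 0 <= t <= 1 -> exists M, sdiff (h t) u M) -> euclidean_path h ->
  isotopic_to_id (extend (h 1)) /\
  isotopic_to_id (@inversion R n \o extend (h 1) \o @inversion R n).
Proof.
move=> h0 hb hd hP; have hc := euclidean_path_close hP.
have hdet := euclidean_path_det h0 hd hP.
split.
  exists (fun t => extend (h t)); split=> // [[x|]|t t01|t t01] //=.
  - by rewrite h0.
  - exact/extend_bijective/hb.
  - exists [::] => u _; have [M dM] := hd t u t01; exists M; last exact: hdet dM.
    exact: sphere_diff_extend.
have Jbij : bijective (@inversion R n) by exists (@inversion R n); exact: inversionK.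
exists (fun t => @inversion R n \o extend (h t) \o @inversion R n).
split=> //.
- move=> p /=; rewrite [extend (h 0) _](_ : _ = inversion p) ?inversionK//.
  by case: (inversion p) => //= x; rewrite h0.
- by move=> t t01; apply: bij_comp => //; apply: bij_comp => //; exact/extend_bijective/hb.
- move=> t t01; have [g hK gK] := hb t t01.
  (* At 0 the inner inversion leaves the chart; the second point is the one sent to infinity. *)
  exists [:: Some 0; inversion (Some (g 0))] => u.
  rewrite !inE negb_or => /andP[u0 ug].
  have {}u0 : u != 0 by apply: contra u0 => /eqP ->.
  have uE : inversion (Some u) = Some ((enorm u ^+ 2)^-1 *: u) by rewrite /= (negbTE u0).
  set v := _ *: u in uE.
  have hv0 : h t v != 0.
    by apply: contra ug => /eqP hv; rewrite -hv hK -uE inversionK.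
  have [A dA A0] := sphere_diff_inversion u0.
  have [B dB B0] := sphere_diff_inversion hv0.
  have [M dM] := hd t v t01; have M0 := hdet _ t01 _ _ dM.
  exists (A *m (M *m B)).
    apply: sphere_diff_comp uE dA _; apply: sphere_diff_comp _ dB => //.
    exact: sphere_diff_extend.
  (* The negative signs of the two inversions cancel. *)
  by rewrite !det_mulmx nmulr_rgt0// pmulr_rlt0.
move=> e e0; have [d d0 H] := hc _ e0; exists d => // s t s01 t01 st.
have [H1 H2] := H _ _ s01 t01 st; split=> [p|p q] /=; rewrite !inversion_isometry//.
Qed.

End euclidean_paths.

(** * Flows conjugate to translations *)

Section isotopies.
Context {R : realType} {n : nat}.
Local Notation V := 'rV[R]_n.
Local Notation S := (sphere R n).
Local Notation J := (@inversion R n).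

(* The conjugates by the inversion need not come from a euclidean path. *)
Definition euclidean_isotopic (h : V -> V) :=
  isotopic_to_id (extend h) /\ isotopic_to_id (J \o extend h \o J).

Lemma euclidean_isotopic_eq h g : h =1 g -> euclidean_isotopic h -> euclidean_isotopic g.
Proof. by move=> /funext ->. Qed.

Lemma euclidean_isotopic_comp h g : euclidean_isotopic h -> euclidean_isotopic g ->
  euclidean_isotopic (g \o h).
Proof.
move=> [h1 h2] [g1 g2]; have hg p : extend (g \o h) p = extend g (extend h p) by case: p.
split; first by apply: isotopic_to_id_eq (isotopic_to_id_comp h1 g1) => p; rewrite hg.
by apply: isotopic_to_id_eq (isotopic_to_id_comp h2 g2) => p /=; rewrite hg inversionK.
Qed.

(** Bounds all inverses along the segment at once, which fixes the step length in
    [compact_linear]. *)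
Lemma segment_expanding (M : 'M[R]_n) :
  (forall s : R, 0 <= s <= 1 -> (1 - s)%:M + s *: M \in unitmx) ->
  exists2 d : R, 0 < d & forall s : R, `[0, 1]%classic s -> forall x : V,
    `|x| <= d^-1 * `|x *m ((1 - s)%:M + s *: M)|.
Proof.
move=> uM; apply: (compact_uniform (P := fun d (s : R) => forall x : V,
    `|x| <= d^-1 * `|x *m ((1 - s)%:M + s *: M)|) (@segment_compact R 0 1)).
  move=> d d' s d'0 dd' H x; rewrite (le_trans (H x))// ler_wpM2r// lef_pV2//.
  by rewrite posrE (lt_le_trans d'0).
move=> s; rewrite /= in_itv/= => s01; have us := uM s s01.
pose C := mxnorm1 (invmx ((1 - s)%:M + s *: M)) + 1.
have C0 : 0 < C by rewrite ltr_wpDl ?mxnorm1_ge0.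
pose B := mxnorm1 (M - 1%:M) + 1; have B0 : 0 < B by rewrite ltr_wpDl ?mxnorm1_ge0.
exists (2 * C)^-1; first by rewrite invr_gt0 mulr_gt0.
have a0 : 0 < (2 * C * B)^-1 by rewrite invr_gt0 !mulr_gt0.
near=> t => x; rewrite invrK.
have ts : `|s - t| < (2 * C * B)^-1 by near: t; exact: cvgr_dist_lt.
have h1 : `|x| <= C * `|x *m ((1 - s)%:M + s *: M)|.
  by rewrite (le_trans (normr_unitmx x us))// ler_wpM2r// lerDl.
have h2 : `|x *m ((1 - s)%:M + s *: M)| <=
    `|x *m ((1 - t)%:M + t *: M)| + `|s - t| * (B * `|x|).
  have -> : x *m ((1 - s)%:M + s *: M) = x *m ((1 - t)%:M + t *: M) + (s - t) *: (x *m (M - 1%:M)).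
    rewrite !mulmxDr !mul_mx_scalar -!scalemxAr mulmxN mulmx1 !scalerBr !scalerBl !scale1r.
    by mxabel.
  rewrite (le_trans (ler_normD _ _))// lerD2l normrZ ler_wpM2l//.
  by rewrite (le_trans (normr_mulmx _ _))// ler_wpM2r// lerDl.
have h3 : C * (`|s - t| * (B * `|x|)) <= `|x| / 2.
  have -> : `|x| / 2 = C * ((2 * C * B)^-1 * (B * `|x|)).
    by field; rewrite !gt_eqF.
  by rewrite ler_pM2l// ler_wpM2r ?mulr_ge0 ?(ltW B0)// ltW.
have := ler_wpM2l (ltW C0) h2; lra.
Unshelve. all: by end_near. Qed.

(** Solutions of x + g x = y are the fixed points of the contraction x |-> y - g x. *)
Lemma small_perturbation_bijective (g : V -> V) :
  (forall x y, `|g x - g y| <= 2^-1 * `|x - y|) -> bijective (fun x => x + g x).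
Proof.
move=> gl.
have expanding x y : `|x - y| <= 2 * `|x + g x - (y + g y)|.
  have := ler_normB (x + g x - (y + g y)) (g x - g y); have := gl x y.
  rewrite [X in _ -> `|X| <= _ -> _](_ : _ = x - y); last by mxabel.
  by lra.
suff /choice[k kE] : forall y, exists x, x + g x = y.
  exists k => // x; apply/eqP; rewrite -subr_eq0 -normr_le0 (le_trans (expanding _ _))//.
  by rewrite kE subrr normr0 mulr0.
move=> y; pose f x := y - g x.
have fl x z : `|f x - f z| <= 2^-1 * `|x - z|.
  by rewrite /f [X in `|X|](_ : _ = - (g x - g z)) ?normrN//; mxabel.
have h2 : (0 : R) <= 2^-1 by rewrite invr_ge0.
have [|||p _ pE] := @banach_fixed_point R V setT (totalfun_ setT f).
- exists (NngNum h2); split=> /=; first by rewrite invf_lt1 ?ltr1n.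
  by move=> [x z] _ /=; exact: fl.
- exact: closedT.
- by exists 0.
by exists p => //=; rewrite {1}pE /= /totalfun_ /f subrK.
Qed.

(** The path is P T_(t c) Q. Its values at times [s] and [t] differ by the translation by (s - t) c
    inside [P], which the second difference bound controls; the Lipschitz bound of [Q] returns from
    Q x + t c to the value at time [t]. *)
Lemma flow_isotopy (P Q : V -> V) (c : V) (L : R) : cancel P Q -> cancel Q P ->
  0 < L -> (forall x y, `|P x - P y| <= L * `|x - y|) ->
  (forall x y, `|Q x - Q y| <= L * `|x - y|) ->
  (forall u, exists M, sdiff P u M) ->
  (forall e : R, 0 < e -> exists2 d : R, 0 < d & forall x y v, `|v| < d ->
    `|(P (x + v) - P x) - (P (y + v) - P y)| <= e * `|x - y|) ->
  euclidean_isotopic (fun x => P (Q x + c)).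
Proof.
move=> PK QK L0 PL QL dP P2.
apply: (@euclidean_isotopic_eq (fun x => P (Q x + 1 *: c))).
  by move=> x; rewrite scale1r.
apply: (@euclidean_isotopy _ _ (fun t x => P (Q x + t *: c))) => [x|t _|t u _|e e0].
- by rewrite scale0r addr0 QK.
- by exists (fun x => P (Q x - t *: c)) => x; rewrite PK ?addrK ?subrK QK.
- have [M dM] := dP (Q u).
  (* A Lipschitz [Q] makes [P] expanding, hence its derivative invertible. *)
  have uM : M \in unitmx.
    apply: unitmx_injective; apply: sdiff_unitmx ltr01 _ dM => x y _ _.
    by rewrite -{1}[x]PK -{1}[y]PK; exact: QL.
  have dQ := sdiff_inverse QK QL uM dM.
  have dT := sdiffD dQ (sdiff_cst (t *: c) u).
  have [N dN] := dP (Q u + t *: c).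
  by eexists; exact: sdiff_comp dT dN.
have [d d0 Hd] := P2 _ (divr_gt0 e0 L0).
have c1 : 0 < `|c| + 1 by rewrite ltr_wpDl.
exists (Num.min d (e / L) / (`|c| + 1)) => [|s t _ _].
  by rewrite divr_gt0// lt_min d0 divr_gt0.
rewrite ltr_pdivlMr// => st.
have : `|(s - t) *: c| < Num.min d (e / L).
  by rewrite normrZ (le_lt_trans _ st)// ler_wpM2l// lerDl.
rewrite lt_min ltr_pdivlMr// => /andP[vd ve].
have E x : Q x + s *: c = Q x + t *: c + (s - t) *: c.
  by rewrite scalerBl; mxabel.
split=> [x|x y].
  rewrite E (le_trans (PL _ _))// addrAC subrr add0r.
  by rewrite mulrC (le_trans (ltW ve))// ler_peMr ?(ltW e0)// lerDl.
rewrite !E [X in `|X|](_ : _ = (P (Q x + t *: c + (s - t) *: c) - P (Q x + t *: c)) -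
   (P (Q y + t *: c + (s - t) *: c) - P (Q y + t *: c))); last by mxabel.
rewrite (le_trans (Hd _ _ _ vd))//.
have := QL (P (Q x + t *: c)) (P (Q y + t *: c)); rewrite !PK => k.
rewrite (le_trans (ler_wpM2l (ltW (divr_gt0 e0 L0)) k))// mulrA mulfVK ?gt_eqF//.
Qed.

Lemma translation_isotopy (v : V) : euclidean_isotopic (fun x => x + v).
Proof.
apply: (@flow_isotopy id id v 1) => // [x y|x y|u|e e0]; rewrite ?mul1r//.
  by exists 1%:M; exact: sdiff_id.
exists 1 => // x y w _; rewrite [X in `|X|](_ : _ = 0) ?normr0 ?mulr_ge0 ?(ltW e0)//.
mxabel.
Qed.

End isotopies.

(** * Infinite repetition *)

Section infinite_repetition.
Context {R : realType} {n : nat}.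
Local Notation V := 'rV[R]_n.
Context (i0 : 'I_n) (r : R) (r0 : 0 < r).

(* [R^n] is cut into slabs of width [2 (r + 1)] orthogonal to the axis [i0]; the
   slab of index [k] is centered at [k *: c]. *)
Let width : R := 2 * (r + 1).
Let c : V := width *: delta_mx 0 i0.
Let slab (x : V) : int := Num.floor (x 0 i0 / width + 2^-1).
Let center (x : V) : V := (slab x)%:~R *: c.

Let width0 : 0 < width. Proof. by rewrite mulr_gt0// addr_gt0. Qed.

Let slab_shift (x : V) (j : int) : slab (x + j%:~R *: c) = slab x + j.
Proof.
rewrite /slab !mxE !eqxx mulr1 mulrDl mulfK ?gt_eqF//.
by rewrite addrAC floorDrz ?intr_int// intrKfloor.
Qed.

Let far (x : V) (j : int) : j != slab x -> r + 1 <= `|x - j%:~R *: c|.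
Proof.
move=> jx; apply: le_trans (normr_entry _ 0 i0); rewrite !mxE !eqxx mulr1.
have wE : x 0 i0 - j%:~R * width = (x 0 i0 / width - j%:~R) * width.
  by rewrite mulrBl mulfVK// gt_eqF.
rewrite wE normrM (gtr0_norm width0).
suff : 2^-1 <= `|x 0 i0 / width - j%:~R|.
  by move=> H; have := ler_wpM2r (ltW width0) H; rewrite /width; lra.
rewrite leNgt; apply: contra jx => jx; apply/eqP/esym/floor_def; rewrite intrD.
by move: jx; rewrite ltr_norml; set a := x 0 i0 / width; lra.
Qed.

Let slab_near (x : V) (j : int) : `|x - j%:~R *: c| < r + 1 -> slab x = j.
Proof.
move=> xj; apply/eqP; rewrite eq_sym; apply: contraTT xj => /far.
by rewrite -leNgt.
Qed.

(** Only slabs of index >= 0 carry copies, so that a shift by one slab leaves a single copy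
    uncancelled. *)
Let repeat (g : V -> V) (x : V) : V := if 0 <= slab x then g (x - center x) else 0.

Let repeat_other (g : V -> V) (x : V) (j : int) : (forall y, r + 1 <= `|y| -> g y = 0) ->
  j != slab x -> g (x - j%:~R *: c) = 0.
Proof. by move=> g0 /far; exact: g0. Qed.

(** For points of different slabs, each value is compared with the same copy of [g] at the other
    point, where it vanishes; hence the factor 2. *)
Let repeat_lipschitz (g : V -> V) (L : R) : (forall y, r + 1 <= `|y| -> g y = 0) ->
  (forall x y, `|g x - g y| <= L * `|x - y|) ->
  forall x y, `|repeat g x - repeat g y| <= 2 * L * `|x - y|.
Proof.
move=> g0 gL x y; have L0 : 0 <= L * `|x - y| by rewrite (le_trans _ (gL x y)).
have shift z a b : `|g (a - z) - g (b - z)| <= L * `|a - b|.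
  by rewrite (le_trans (gL _ _))// opprB addrA subrK.
have [xy|xy] := eqVneq (slab x) (slab y).
  rewrite /repeat /center xy; case: ifP => _; last by rewrite subrr normr0 -mulrA mulr_ge0.
  by rewrite (le_trans (shift _ _ _))// -mulrA ler_peMl// ler1n.
have bound a b : slab a != slab b -> L * `|a - b| >= 0 -> `|repeat g a| <= L * `|a - b|.
  move=> ab ab0; rewrite /repeat; case: ifP => _; last by rewrite normr0.
  rewrite -[g _]subr0 -(repeat_other g0 (x := b) (j := slab a))//; exact: shift.
rewrite (le_trans (ler_normB _ _))//.
have := bound x y xy L0; have := bound y x; rewrite eq_sym distrC => /(_ xy L0); lra.
Qed.

(** This uses the unit margin around the support: a point that changes slab under a translation by
    |v| < 1 ends outside the supports of both copies. *)
Let repeat_difference (g : V -> V) (v x : V) : (forall y, r <= `|y| -> g y = 0) -> `|v| < 1 ->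
  repeat g (x + v) - repeat g x = repeat (fun y => g (y + v) - g y) x.
Proof.
move=> g0 v1; rewrite /repeat {3 4}/center.
have g1 y : r + 1 <= `|y| -> g y = 0 by move=> h; apply: g0; lra.
have E : repeat g (x + v) = if 0 <= slab x then g (x - center x + v) else 0.
  rewrite /repeat /center; have [->|xv] := eqVneq (slab (x + v)) (slab x).
    by rewrite addrAC.
  have -> : x - (slab x)%:~R *: c + v = x + v - (slab x)%:~R *: c by rewrite addrAC.
  rewrite (repeat_other g1 (x := x + v)) 1?eq_sym// if_same.
  case: ifP => // _; apply: g0.
  have := far xv; rewrite [x + v - _]addrAC => h.
  have := lerB_dist (x - (slab (x + v))%:~R *: c) (- v); rewrite opprK normrN; lra.
by rewrite -/(repeat g (x + v)) E; case: ifP => // _; rewrite subrr.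
Qed.

(** Within distance 1 of [u], [repeat g] is the one copy, or the zero map, attached to the slab of
    [u], even across its boundary. *)
Let repeat_sdiff (g : V -> V) : (forall y, r <= `|y| -> g y = 0) ->
  (forall u, exists M, sdiff g u M) -> forall u, exists M, sdiff (repeat g) u M.
Proof.
move=> g0 dg u; have g1 y : r + 1 <= `|y| -> g y = 0 by move=> h; apply: g0; lra.
have E x : `|x - u| < 1 -> (if 0 <= slab u then g (x - center u) else 0) = repeat g x.
  move=> xu; have := repeat_difference u g0 xu.
  rewrite (_ : u + (x - u) = x); last by mxabel.
  move=> /eqP; rewrite subr_eq => /eqP ->.
  rewrite /repeat; case: ifP => // _; last by rewrite addr0.
  by rewrite subrK; congr g; mxabel.
have [ku|ku] := boolP (0 <= slab u); last first.
  exists 0; apply: sdiff_near ltr01 _ (sdiff_cst 0 u) => x /E; by rewrite (negbTE ku).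
have [M dM] := dg (u - center u).
have := sdiff_comp (sdiffD (sdiff_id u) (sdiff_cst (- center u) u)) dM => dgc.
by eexists; apply: sdiff_near ltr01 _ dgc => x /E; rewrite ku.
Qed.

Let repeat_map (p : V -> V) (x : V) : V := x + repeat (fun y => p y - y) x.

Let repeat_mapE p x : repeat_map p x =
  if 0 <= slab x then center x + p (x - center x) else x.
Proof.
rewrite /repeat_map /repeat; case: ifP => _; last by rewrite addr0.
mxabel.
Qed.

Let slab_repeat_map (p : V -> V) (x : V) : (forall y, `|y| < r -> `|p y| < r) ->
  (forall y, r <= `|y| -> p y = y) -> slab (repeat_map p x) = slab x.
Proof.
move=> pr p1; rewrite repeat_mapE; case: ifP => // _.
have [xr|xr] := ltP `|x - center x| r; last by rewrite p1// addrC subrK.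
apply: slab_near; rewrite -/(center x) addrAC subrr add0r.
by have := pr _ xr; lra.
Qed.

Let repeat_mapK (p q : V -> V) : (forall y, `|y| < r -> `|p y| < r) ->
  (forall y, r <= `|y| -> p y = y) -> cancel p q ->
  cancel (repeat_map p) (repeat_map q).
Proof.
move=> pr p1 pK x; have s := slab_repeat_map x pr p1.
rewrite [LHS]repeat_mapE s /center s -/(center x) repeat_mapE; case: (0 <= slab x) => //.
have -> : center x + p (x - center x) - center x = p (x - center x) by mxabel.
by rewrite pK addrC subrK.
Qed.

(* [repeat_map p] is the product [P] of the conjugates of [p] by [T^k], [k >= 0],
   where [T] is the translation by [c]; hence [q = T P T^-1 P^-1]. *)
Lemma compact_support_isotopy (p q : V -> V) : cancel p q -> cancel q p ->
  (forall y, r <= `|y| -> p y = y) ->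
  (forall u, exists2 M, M \in unitmx & sdiff p u M) -> euclidean_isotopic q.
Proof.
move=> pK qK p1 dp.
have q1 y : r <= `|y| -> q y = y by move=> /p1 {1}<-; rewrite pK.
have ball_stable (f g : V -> V) (y : V) : cancel f g ->
    (forall z, r <= `|z| -> f z = z) -> `|y| < r -> `|f y| < r.
  move=> fK f1 yr; rewrite ltNge; apply/negP => fyr.
  have := f1 _ fyr => /(congr1 g); rewrite !fK => fy.
  by move: yr; rewrite ltNge -{1}fy fyr.
have pr y : `|y| < r -> `|p y| < r by exact: ball_stable pK p1.
have qr y : `|y| < r -> `|q y| < r by exact: ball_stable qK q1.
have d1 u : exists M, sdiff (fun y => p y - y) u M.
  have [M _ dM] := dp u; exists (M - 1 *: 1%:M).
  rewrite -scaleNr; apply: sdiff_near ltr01 _ (sdiffD dM (sdiffZ (-1) (sdiff_id u))) => x _.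
  by rewrite scaleN1r.
have g0 (f : V -> V) : (forall y, r <= `|y| -> f y = y) -> forall y, r <= `|y| -> f y - y = 0.
  by move=> f1 y /f1 ->; rewrite subrr.
have g1 (f : V -> V) : (forall y, r <= `|y| -> f y = y) -> forall y, r + 1 <= `|y| -> f y - y = 0.
  by move=> f1 y yr; apply: g0 => //; lra.
have [K K0 pL] := compact_support_lipschitz (g0 _ p1) d1.
have [L L0 pE] := compact_support_expanding r0 (can_inj pK) p1 dp.
have qL x y : `|q x - x - (q y - y)| <= (L + 1) * `|x - y|.
  have -> : q x - x - (q y - y) = (q x - q y) - (x - y) by mxabel.
  rewrite (le_trans (ler_normB _ _))// mulrDl mul1r lerD2r.
  by rewrite (le_trans (pE _ _))// !qK.
pose P := repeat_map p; pose Q := repeat_map q.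
have PK : cancel P Q by exact: repeat_mapK.
have QK : cancel Q P by exact: repeat_mapK.
have lipmap (f : V -> V) (B : R) : (forall y, r <= `|y| -> f y = y) ->
    (forall x y, `|f x - x - (f y - y)| <= B * `|x - y|) ->
    forall x y, `|repeat_map f x - repeat_map f y| <= (1 + 2 * B) * `|x - y|.
  move=> f1 fB x y; rewrite /repeat_map.
  have := repeat_lipschitz (g1 _ f1) fB x y; set a := repeat _ x; set b := repeat _ y => h.
  have -> : x + a - (y + b) = (x - y) + (a - b) by mxabel.
  by rewrite (le_trans (ler_normD _ _))// mulrDl mul1r lerD2l.
pose B := 1 + 2 * K + 2 * (L + 1).
have B0 : 0 < B by rewrite /B; lra.
have PL x y : `|P x - P y| <= B * `|x - y|.
  by rewrite (le_trans (lipmap _ _ p1 pL x y))// ler_wpM2r// /B; lra.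
have QL x y : `|Q x - Q y| <= B * `|x - y|.
  by rewrite (le_trans (lipmap _ _ q1 qL x y))// ler_wpM2r// /B; lra.
have dP u : exists M, sdiff P u M.
  have [M dM] := repeat_sdiff (g0 _ p1) d1 u; exists (1%:M + M).
  exact: sdiffD (sdiff_id u) dM.
have P2 (e : R) : 0 < e -> exists2 d : R, 0 < d & forall x y v, `|v| < d ->
    `|(P (x + v) - P x) - (P (y + v) - P y)| <= e * `|x - y|.
  move=> e0; have e20 : 0 < e / 2 by rewrite divr_gt0.
  (* The second difference of [P] repeats that of [p]; repetition doubles Lipschitz constants, hence
     [e / 2]. *)
  have [d d0 Hd] := compact_support_second_difference (g0 _ p1) d1 e20.
  exists (Num.min d 1) => [|x y v]; first by rewrite lt_min d0 ltr01.
  rewrite lt_min => /andP[vd v1].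
  have E z : P (z + v) - P z =
      v + repeat (fun y => (p (y + v) - (y + v)) - (p y - y)) z.
    by rewrite -(repeat_difference z (g0 _ p1) v1) /P /repeat_map; mxabel.
  have -> : P (x + v) - P x - (P (y + v) - P y) =
      repeat (fun y => (p (y + v) - (y + v)) - (p y - y)) x -
      repeat (fun y => (p (y + v) - (y + v)) - (p y - y)) y.
    by rewrite !E; mxabel.
  have -> : e * `|x - y| = 2 * (e / 2) * `|x - y| by field.
  apply: repeat_lipschitz => [z zr|a b]; last exact: Hd.
  have := lerB_dist z (- v); rewrite opprK normrN => h.
  by rewrite !(g0 _ p1) ?subrr//; lra.
have flow := flow_isotopy (- c) PK QK B0 PL QL dP P2.
apply: euclidean_isotopic_eq (euclidean_isotopic_comp flow (translation_isotopy c)).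
move=> y /=.
have sQ : slab (Q y) = slab y by exact: slab_repeat_map.
have sc : slab (Q y - c) = slab y - 1.
  by rewrite -sQ -(slab_shift (Q y) (-1)) intrN scaleN1r.
have cE : center (Q y - c) = center y - c.
  by rewrite /center sc intrB scalerBl scale1r.
rewrite /P repeat_mapE sc cE.
have -> : Q y - c - (center y - c) = Q y - center y by mxabel.
have far0 : slab y != 0 -> q y = y.
  move=> y0; apply: q1; have := far (x := y) (j := 0); rewrite eq_sym y0 scale0r subr0.
  by move=> /(_ isT); lra.
rewrite /Q repeat_mapE.
(* [Q] acts on slabs k >= 0, and after the shift [P] acts on those with k - 1 >= 0. For k > 0 they
   cancel, for k < 0 neither acts, and for k = 0 only [q] remains. *)
have [y0|y0|y0] := ltgtP (slab y) 0.
- have -> : (0 <= slab y - 1) = false by apply/negbTE; rewrite -ltNge; lia.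
  by rewrite subrK far0// lt_eqF.
- have -> : (0 <= slab y - 1) = true by lia.
  have -> : center y + q (y - center y) - center y = q (y - center y) by mxabel.
  by rewrite qK far0 ?gt_eqF//; mxabel.
- by rewrite y0 /= subrK /center y0 scale0r add0r subr0.
Qed.

End infinite_repetition.

(** * Compactly supported diffeomorphisms *)

Section compact_diffeomorphisms.
Context {R : realType} {n : nat}.
Local Notation V := 'rV[R]_n.

Definition compact_diffeo (h : V -> V) := [/\ bijective h,
  exists2 r : R, 0 < r & forall x, r <= `|x| -> h x = x &
  forall u, exists2 M, M \in unitmx & sdiff h u M].

Lemma compact_diffeo_comp h g :
  compact_diffeo h -> compact_diffeo g -> compact_diffeo (g \o h).
Proof.
move=> [bh [r r0 hr] dh] [bg [s s0 gs] dg]; split.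
- exact: bij_comp.
- exists (Num.max r s) => [|x]; first by rewrite lt_max r0.
  by rewrite ge_max => /andP[/hr /= -> /gs].
- move=> u; have [M uM dM] := dh u; have [N uN dN] := dg (h u).
  by exists (M *m N); [rewrite unitmx_mul uM|exact: sdiff_comp dM dN].
Qed.

Lemma compact_diffeo_inverse h g : cancel h g -> cancel g h ->
  compact_diffeo h -> compact_diffeo g.
Proof.
move=> hK gK [bh [r r0 hr] dh]; split; first by exists h.
  by exists r => // x /hr {1}<-; rewrite hK.
have [L L0 hL] := compact_support_expanding r0 (can_inj hK) hr dh.
move=> u; have [M uM dM] := dh (g u); exists (invmx M); first by rewrite unitmx_inv.
apply: (sdiff_inverse gK (L := L) _ uM dM) => x y.
by rewrite (le_trans (hL _ _))// !gK.
Qed.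

Lemma compact_diffeo_isotopic h : (0 < n)%N -> compact_diffeo h -> euclidean_isotopic h.
Proof.
move=> n0 hd; have [[g hK gK] _ _] := hd.
have [_ [r r0 gr] dg] := compact_diffeo_inverse hK gK hd.
exact: (compact_support_isotopy (Ordinal n0) r0 gK hK gr dg).
Qed.

Lemma sqnorm_le (x : V) : (x *m x^T) 0 0 <= (n%:R * `|x|) ^+ 2.
Proof.
by rewrite -dotp_mulmx -sqr_enorm ler_pXn2r ?nnegrE ?enorm_ge0 ?mulr_ge0// enorm_le_norm.
Qed.

Lemma sqnorm_ge (x : V) : `|x| ^+ 2 <= (x *m x^T) 0 0.
Proof. by rewrite -dotp_mulmx -sqr_enorm ler_pXn2r ?nnegrE ?enorm_ge0// norm_le_enorm. Qed.

Lemma normr_cutoff (x : V) : `|cutoff x| <= 1.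
Proof.
rewrite normr_mx11 !mxE /= mulr1n /sqpos.
have s0 (s : R) : 0 <= Num.max s 0 ^+ 2 by rewrite sqr_ge0.
rewrite ger0_norm//; set t := 1 - _; have t1 : Num.max t 0 <= 1.
  by rewrite ge_max ler01 andbT /t gerBl.
by rewrite -[leRHS](expr1n _ 2) ler_pXn2r ?nnegrE// le_max lexx orbT.
Qed.

(** The admissible [e] does not depend on the scale [r]: the cut-off varies at rate K / r while |k|
    <= 2 r e on its support, so the product has Lipschitz constant at most (2 K + 1) e = 1 / 2. *)
Lemma cutoff_perturbation : exists2 e : R, 0 < e &
  forall (k : V -> V) (r d : R), 0 < r -> 2 * r < d ->
    (forall x, `|x| <= 2 * r -> `|k x| <= 2 * r * e) ->
    (forall x y, `|x| < d -> `|y| < d -> `|k x - k y| <= e * `|x - y|) ->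
    (forall u, `|u| < d -> exists M, sdiff k u M) ->
    exists2 h, compact_diffeo h &
      exists2 c : R, 0 < c & forall x, `|x| < c -> h x = x + k x.
Proof.
have c0 (x : V) : 2 <= `|x| -> cutoff x = 0.
  move=> x2; apply: cutoff0; apply: le_trans (sqnorm_ge x); nra.
have [K K0 cL] := compact_support_lipschitz c0 (@sdiff_cutoff R n).
pose C := 2 * K + 1; have C0 : 0 < C by rewrite addr_gt0// mulr_gt0.
pose e := (2 * C)^-1; have e0 : 0 < e by rewrite invr_gt0 mulr_gt0.
have eC : e * C = 2^-1 by rewrite /e invfM mulfVK// gt_eqF.
exists e => // k r d r0 rd k1 kL dk.
pose g x := cutoff (r^-1 *: x) *m k x.
have rV : 0 < r^-1 by rewrite invr_gt0.
have cr (x : V) : 2 * r <= `|x| -> cutoff (r^-1 *: x) = 0.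
  by move=> xr; apply: c0; rewrite normrZ gtr0_norm// mulrC ler_pdivlMr.
have g0 (x : V) : 2 * r <= `|x| -> g x = 0 by move=> xr; rewrite /g cr// mul0mx.
have cLr (x y : V) : `|cutoff (r^-1 *: x) - cutoff (r^-1 *: y)| <= K * (r^-1 * `|x - y|).
  by rewrite (le_trans (cL _ _))// -scalerBr normrZ gtr0_norm.
have mulN (a : 'M[R]_1) (v : V) : `|a *m v| = `|a| * `|v|.
  by rewrite mulmx11 normrZ normr_mx11.
have part (x y : V) : `|x| <= 2 * r -> `|(cutoff (r^-1 *: x) - cutoff (r^-1 *: y)) *m k x| <=
    2 * K * e * `|x - y|.
  move=> xr; rewrite mulN (le_trans (ler_pM _ _ (cLr x y) (k1 _ xr)))//.
  have -> // : K * (r^-1 * `|x - y|) * (2 * r * e) = 2 * K * e * `|x - y|.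
  by field; rewrite gt_eqF.
have gL (x y : V) : `|g x - g y| <= 2^-1 * `|x - y|.
  wlog xr : x y / `|x| <= 2 * r.
    move=> H; have [/H//|xr] := leP `|x| (2 * r).
    have [yr|yr] := leP `|y| (2 * r); first by rewrite distrC (distrC x) H.
    by rewrite (g0 x (ltW xr)) (g0 y (ltW yr)) subrr normr0 mulr_ge0.
  have Ke : 0 <= 2 * K * e by rewrite !mulr_ge0 ?(ltW K0) ?(ltW e0).
  have [yd|yd] := ltP `|y| d; last first.
    have yr : 2 * r <= `|y| by lra.
    rewrite [g y]g0// subr0 /g -[cutoff _]subr0 -(cr y yr) (le_trans (part _ _ xr))//.
    by rewrite ler_wpM2r// -eC /C; lra.
  have -> : g x - g y = (cutoff (r^-1 *: x) - cutoff (r^-1 *: y)) *m k x +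
      cutoff (r^-1 *: y) *m (k x - k y).
    by rewrite /g mulmxBl mulmxBr; mxabel.
  rewrite (le_trans (ler_normD _ _))// -eC mulrDr mulr1 mulrDl lerD//.
    by rewrite [e * _]mulrC; exact: part.
  rewrite mulN (le_trans (ler_piMl _ (normr_cutoff _)))//.
  by apply: kL => //; lra.
have dg u : exists M, sdiff g u M.
  have [ud|ud] := ltP `|u| d; last first.
    exists 0; have dr : 0 < d - 2 * r by lra.
    apply: sdiff_near dr _ (sdiff_cst 0 u) => x xu; rewrite g0//.
    by have := lerB_dist u x; rewrite distrC; lra.
  have [E dE] := sdiff_cutoff (r^-1 *: u); have [M dM] := dk u ud.
  by eexists; exact: sdiff_mul (sdiff_comp (sdiffZ r^-1 (sdiff_id u)) dE) dM.
have gb := small_perturbation_bijective gL.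
have exp x y : `|x - y| <= 2 * `|x + g x - (y + g y)|.
  have := gL x y; have := ler_normB (x + g x - (y + g y)) (g x - g y).
  rewrite [X in `|X| <= _ -> _](_ : _ = x - y); last by mxabel.
  by lra.
exists (fun x => x + g x).
  split=> //; first by exists (2 * r) => [|x /g0 ->]; rewrite ?addr0// mulr_gt0.
  move=> u; have [M dM] := dg u; have dh := sdiffD (sdiff_id u) dM.
  exists (1%:M + M) => //; apply: unitmx_injective.
  by apply: sdiff_unitmx ltr01 _ dh => x y _ _; exact: exp.
have n1 : 0 < n%:R + 1 :> R by rewrite ltr_wpDl.
(* The divisor places the sup norm ball inside the Euclidean ball of radius [r], where the cut-off
   is 1. *)
exists (r / (n%:R + 1)) => [|x xr]; first by rewrite divr_gt0.
rewrite /g cutoff1 ?mul1mx// (le_trans (sqnorm_le _))// -[leRHS](expr1n _ 2).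
rewrite ler_pXn2r ?nnegrE ?mulr_ge0// normrZ gtr0_norm// mulrCA ler_pdivrMl// mulr1.
rewrite ltr_pdivlMr// in xr; have := normr_ge0 x; lra.
Qed.

Lemma compact_translation (v : V) : exists2 h, compact_diffeo h &
  exists2 c : R, 0 < c & forall x, `|x| < c -> h x = x + v.
Proof.
have [e e0 H] := cutoff_perturbation.
(* A constant perturbation has Lipschitz constant 0, so a scale with |v| <= r e suffices. *)
pose r := `|v| / e + 1; have r0 : 0 < r by rewrite ltr_wpDl// divr_ge0// ltW.
apply: (H (fun=> v) r (2 * r + 1)) => //.
- by rewrite ltrDl.
- move=> x _; have : `|v| <= r * e by rewrite mulrDl mulfVK ?gt_eqF// mul1r lerDl ltW.
  have := normr_ge0 v; lra.
- by move=> x y _ _; rewrite subrr normr0 mulr_ge0// ltW.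
- by move=> u _; exists 0; exact: sdiff_cst.
Qed.

Let linear_near0 (A : 'M[R]_n) := exists2 h, compact_diffeo h &
  exists2 c : R, 0 < c & forall x, `|x| < c -> h x = x *m A.

Let linear_near0_mul A B : linear_near0 A -> linear_near0 B -> linear_near0 (A *m B).
Proof.
move=> [h hd [c c0 hc]] [g gd [d d0 gd']]; exists (g \o h).
  exact: compact_diffeo_comp.
have A0 : 0 < mxnorm1 A + 1 by rewrite ltr_wpDl ?mxnorm1_ge0.
exists (Num.min c (d / (mxnorm1 A + 1))) => [|x]; first by rewrite lt_min c0 divr_gt0.
rewrite lt_min ltr_pdivlMr// => /andP[xc xd] /=.
rewrite hc// gd' ?mulmxA// (le_lt_trans (normr_mulmx _ _))//.
rewrite mulrC (le_lt_trans _ xd)// ler_wpM2l// lerDl//.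
Qed.

(** Along a segment [S], one has [S s = S t *m (invmx (S t) *m S s)], and for close times the last
    factor is so near 1 that [cutoff_perturbation] applies to it. *)
Lemma compact_linear (M : 'M[R]_n) : 0 < \det M -> exists2 h, compact_diffeo h &
  exists2 c : R, 0 < c & forall x, `|x| < c -> h x = x *m M.
Proof.
apply: (det_gt0_ind (P := linear_near0)); first exact: linear_near0_mul.
move=> {}M uM; have [e e0 H] := cutoff_perturbation.
have near1 B : (forall x : V, `|x *m (B - 1%:M)| <= e * `|x|) -> linear_near0 B.
  move=> He; have [|||||h hd [c c0 hc]] := H (mulmx^~ (B - 1%:M)) 1 3.
  - by [].
  - by lra.
  - by move=> x x2; rewrite (le_trans (He x))// mulrC ler_wpM2r// ltW.
  - by move=> x y _ _; rewrite -mulmxBl.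
  - by move=> u _; eexists; exact: sdiff_mulmx.
  exists h => //; exists c => // x /hc ->.
  by rewrite mulmxBr mulmx1 addrC subrK.
pose S (t : R) := (1 - t)%:M + t *: M.
have [d d0 Hd] := segment_expanding uM.
have -> : M = S 1 by rewrite /S subrr raddf0 add0r scale1r.
apply: (unit_interval_chain (P := fun t => linear_near0 (S t))); last by rewrite ler01 lexx.
  apply: near1 => x; rewrite /S subr0 scale0r addr0 subrr mulmx0 normr0.
  by rewrite mulr_ge0// ltW.
pose C := mxnorm1 (M - 1%:M) + 1; have C0 : 0 < C by rewrite ltr_wpDl ?mxnorm1_ge0.
(* Then |s - t| C / d <= e, where [d^-1] bounds the inverses and [C] the slope of the segment. *)
exists (e * d / C) => [|s t s01 t01 st]; first by rewrite divr_gt0// mulr_gt0.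
have uS := uM t t01.
move=> /linear_near0_mul/(_ (near1 (invmx (S t) *m S s) _)).
rewrite mulmxA mulmxV// mul1mx; apply=> x.
have -> : invmx (S t) *m S s - 1%:M = (s - t) *: (invmx (S t) *m (M - 1%:M)).
  have SE : (s - t) *: (M - 1%:M) = S s - S t.
    apply/matrixP => i j; rewrite /S !mxE.
    by case: (i == j); rewrite ?mulr1n ?mulr0n; ring.
  by rewrite scalemxAr SE mulmxBr mulVmx.
rewrite -scalemxAr normrZ mulmxA.
have h1 : `|x *m invmx (S t) *m (M - 1%:M)| <= C * `|x *m invmx (S t)|.
  by rewrite (le_trans (normr_mulmx _ _))// ler_wpM2r// lerDl.
have h2 : `|x *m invmx (S t)| <= d^-1 * `|x|.
  have := Hd t _ (x *m invmx (S t)); rewrite mulmxKV//; apply.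
  by rewrite /= in_itv.
apply: (@le_trans _ _ (`|s - t| * (C * (d^-1 * `|x|)))).
  by rewrite ler_wpM2l// (le_trans h1)// ler_pM2l.
have -> : `|s - t| * (C * (d^-1 * `|x|)) = `|s - t| * C / d * `|x| by ring.
rewrite ler_wpM2r// ler_pdivrMr// -ler_pdivlMr// ltW//.
Qed.

(** After division by its derivative, [F] differs from the identity by a map [k] of strict
    derivative 0 at 0, whose Lipschitz constant is small near 0. *)
Lemma compact_extension (F : V -> V) (M : 'M[R]_n) (d : R) : 0 < d -> F 0 = 0 ->
  (forall u, `|u| < d -> exists M, sdiff F u M) -> sdiff F 0 M -> 0 < \det M ->
  exists2 h, compact_diffeo h &
    exists2 c : R, 0 < c & forall x, `|x| < c -> h x = F x.
Proof.
move=> d0 F0 dF dM M0; have [l ld [c c0 lE]] := compact_linear M0.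
have uM : M \in unitmx by rewrite unitmxE unitfE gt_eqF.
have [e e0 H] := cutoff_perturbation.
pose k x := F x *m invmx M - x.
have dk u N : sdiff F u N -> sdiff k u (N *m invmx M + -1 *: 1%:M).
  move=> dN; have := sdiffD (sdiff_comp dN (sdiff_mulmx (invmx M) _)) (sdiffZ (-1) (sdiff_id u)).
  by apply: sdiff_near ltr01 _ => x _; rewrite scaleN1r.
have dk0 : sdiff k 0 0.
  by have := dk _ _ dM; rewrite mulmxV// scaleN1r subrr.
have [d1 d10 H1] := dk0 _ e0.
pose r := Num.min d d1 / 3.
have m0 : 0 < Num.min d d1 by rewrite lt_min d0.
have r0 : 0 < r by rewrite divr_gt0.
have [rd rd1] : 3 * r <= d /\ 3 * r <= d1.
  by rewrite /r mulrC mulfVK// !ge_min !lexx orbT.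
have k0 : k 0 = 0 by rewrite /k F0 mul0mx subr0.
have kL x y : `|x| < 3 * r -> `|y| < 3 * r -> `|k x - k y| <= e * `|x - y|.
  move=> xr yr; have := H1 x y; rewrite !subr0 mulmx0 subr0.
  by apply; exact: lt_le_trans rd1.
have [|x xr||u ur|h hd [c' c'0 hE]] := H k r (3 * r) r0.
- by lra.
- have := kL x 0; rewrite k0 normr0 !subr0 => /(_ _ _)/le_trans; apply; try lra.
  by rewrite mulrC ler_wpM2r// ltW.
- exact: kL.
- by have [N dN] := dF u (lt_le_trans ur rd); eexists; exact: dk dN.
exists (l \o h); first exact: compact_diffeo_comp.
have hM x : `|x| < c' -> h x = F x *m invmx M by move=> /hE ->; rewrite /k addrC subrK.
have [d2 d20 H2] := sdiff_continuous (sdiff_comp dM (sdiff_mulmx (invmx M) _)) c0.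
exists (Num.min c' d2) => [|x]; first by rewrite lt_min c'0.
rewrite lt_min => /andP[/hM hx x2] /=; rewrite hx lE ?mulmxKV//.
by have := H2 x; rewrite subr0 /= F0 mul0mx subr0; apply.
Qed.

End compact_diffeomorphisms.

(** * Diffeomorphisms of the sphere *)

Section charts.
Context {R : realType} {n : nat}.
Local Notation V := 'rV[R]_n.
Local Notation S := (sphere R n).
Implicit Types (F G : S -> S) (p q : S) (a b : bool).

Local Notation chart := (@sphere_chart R n).

Lemma chartK a : involutive (chart a).
Proof. by case: a => // p; exact: inversionK. Qed.

Lemma chart_isometry a p q : mdist (chart a p) (chart a q) = mdist p q.
Proof. by case: a => //; exact: inversion_isometry. Qed.

Lemma exists_chart p : exists a u, chart a p = Some u.
Proof. by case: p => [u|]; [exists false, u|exists true, 0]. Qed.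

(** Existential in the charts, which makes it easy to establish; [diffeo_at_charts] shows that the
    choice is immaterial. *)
Definition diffeo_at F p := exists a b u v M,
  [/\ chart a p = Some u, chart b (F p) = Some v, M \in unitmx &
      sphere_diff (chart b \o F \o chart a) u M].

Lemma transition_diff a b u v : chart b (chart a (Some u)) = Some v ->
  exists2 M, M \in unitmx & sphere_diff (chart b \o chart a) u M.
Proof.
have idd : exists2 M, M \in unitmx & sphere_diff (@id S) u M.
  exists 1%:M; first exact: unitmx1.
  by split; [exists 1|exact: sdiff_id].
have ivd (F : S -> S) : F =1 @inversion R n -> u != 0 ->
    exists2 M, M \in unitmx & sphere_diff F u M.
  move=> /funext -> /sphere_diff_inversion[M dM M0]; exists M => //.
  by rewrite unitmxE unitfE lt_eqF.
(* For distinct charts, [u = 0] is sent to infinity, against the hypothesis. *)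
case: a; case: b => //=.
- have -> // : @inversion R n \o @inversion R n = id by apply/funext/inversionK.
- by have [->|u0] := eqVneq u 0 => // _; apply: ivd.
- by have [->|u0] := eqVneq u 0 => // _; apply: ivd.
Qed.

Lemma diffeo_at_charts F p : diffeo_at F p -> forall a b u v,
  chart a p = Some u -> chart b (F p) = Some v ->
  exists2 M, M \in unitmx & sphere_diff (chart b \o F \o chart a) u M.
Proof.
move=> [a [b [u [v [M [pu Fv uM dM]]]]]] a' b' u' v' pu' Fv'.
have pE : p = chart a' (Some u') by rewrite -pu' chartK.
have FE : F p = chart b (Some v) by rewrite -Fv chartK.
have [A uA dA] : exists2 A, A \in unitmx & sphere_diff (chart a \o chart a') u' A.
  by apply: (@transition_diff _ _ _ u); rewrite -pE.
have [B uB dB] : exists2 B, B \in unitmx & sphere_diff (chart b' \o chart b) v B.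
  by apply: (@transition_diff _ _ _ v'); rewrite -FE.
exists (A *m (M *m B)); first by rewrite !unitmx_mul uA uM.
have := sphere_diff_comp _ dA (sphere_diff_comp _ dM dB).
rewrite /= -pE -pu chartK Fv => /(_ erefl erefl).
by apply: sphere_diff_near ltr01 _ => x _ /=; rewrite !chartK.
Qed.

Lemma diffeo_at_comp F G p : diffeo_at F p -> diffeo_at G (F p) -> diffeo_at (G \o F) p.
Proof.
move=> [a [b [u [v [M [pu Fv uM dM]]]]]] dG.
have [b' [w Gw]] := exists_chart (G (F p)).
have [N uN dN] := diffeo_at_charts dG Fv Gw.
exists a, b', u, w, (M *m N); split=> //; first by rewrite unitmx_mul uM.
have := sphere_diff_comp _ dM dN; rewrite /= -pu chartK => /(_ Fv).
by apply: sphere_diff_near ltr01 _ => x _ /=; rewrite chartK.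
Qed.

Lemma chordal_SomeB (x y : V) : mdist (Some x : S) (Some y) <= n%:R * `|x - y|.
Proof.
have w1 (z : V) : 1 <= Num.sqrt (1 + enorm z ^+ 2).
  by rewrite -{1}(sqrtr1 R) ler_wsqrtr// lerDl sqr_ge0.
rewrite mdist_chordal /= ler_pdivrMr; last first.
  by rewrite mulr_gt0// (lt_le_trans ltr01).
rewrite (le_trans (enorm_le_norm _))// ler_peMr ?mulr_ge0//.
by rewrite -[leLHS]mulr1 ler_pM.
Qed.

(** Continuity in the chordal metric keeps the values of [F] away from the one point missing from
    the chart [b]. *)
Lemma C1_map_finite F a b u : C1_map F -> chart b (F (chart a (Some u))) <> None ->
  exists2 d : R, 0 < d & forall x, `|x - u| < d -> chart b (F (chart a (Some x))) <> None.
Proof.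
move=> [cF _] Fu; set p := chart a (Some u).
have e0 : 0 < mdist (F p) (chart b None).
  by rewrite mdist_gt0; apply/eqP => Fp; apply: Fu; rewrite Fp chartK.
have := cF p => /metricType_numDomainType.cvgrPdist_lt/(_ _ e0).
move=> /metricType_numDomainType.nbhs_mdistP[d /= d0 H].
have n1 : 0 < n%:R + 1 :> R by rewrite ltr_wpDl.
exists (d / (n%:R + 1)) => [|x]; first by rewrite divr_gt0.
rewrite ltr_pdivlMr// => xu Fx.
have : mdist (F p) (F (chart a (Some x))) < mdist (F p) (chart b None).
  apply: H; rewrite /= chart_isometry (le_lt_trans (chordal_SomeB _ _))// distrC.
  by rewrite mulrC (le_lt_trans _ xu)// ler_wpM2l// lerDl.
by rewrite -Fx chartK ltxx.
Qed.

Lemma C1_map_sphere_diff F a b u : C1_map F -> chart b (F (chart a (Some u))) <> None ->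
  sphere_diff (chart b \o F \o chart a) u
    (jacobian (affine_part (chart b \o F \o chart a)) u).
Proof.
move=> cF Fu; have [d d0 Fd] := C1_map_finite cF Fu; split; first by exists d.
have [_ /(_ a b) dF] := cF; have [_ cJ] := dF u Fu.
by apply: (C1_sdiff d0) => // x /Fd/dF[].
Qed.

Lemma C1_diffeo_at F G p : cancel F G -> cancel G F -> C1_map F -> C1_map G ->
  diffeo_at F p.
Proof.
move=> FK GK cF cG; have [a [u pu]] := exists_chart p.
have [b [v Fv]] := exists_chart (F p).
have pE : p = chart a (Some u) by rewrite -pu chartK.
have FE : F p = chart b (Some v) by rewrite -Fv chartK.
have Fu : chart b (F (chart a (Some u))) <> None by rewrite -pE Fv.
have Gv : chart a (G (chart b (Some v))) <> None by rewrite -FE FK pu.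
have dF := C1_map_sphere_diff cF Fu; have dG := C1_map_sphere_diff cG Gv.
exists a, b, u, v; eexists; split; [exact: pu|exact: Fv| |exact: dF].
apply: sphere_diff_unit dF dG; first by rewrite /= -pE.
by move=> q /=; rewrite chartK FK chartK.
Qed.

Lemma inversion_norm (x : V) : x != 0 -> `|x| ^+ 2 <= enorm x ^+ 2 <= (n%:R * `|x|) ^+ 2.
Proof. by move=> x0; rewrite sqr_enorm dotp_mulmx sqnorm_ge sqnorm_le. Qed.

Lemma compact_diffeo_at (h : V -> V) p : compact_diffeo h -> diffeo_at (extend h) p.
Proof.
move=> [bh [r r0 hr] dh]; case: p => [u|].
  have [M uM dM] := dh u.
  by exists false, false, u, (h u), M; split=> //; exact: sphere_diff_extend.
exists true, true, 0, 0, 1%:M; split=> //; first exact: unitmx1.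
(* If |x| < 1 / ((n + 1)^2 r) and x is not 0, its inversion has norm at least [r], where [h] is the
   identity; [n + 1] compares the two norms. *)
have nr : 0 < (n%:R + 1) ^+ 2 * r by rewrite mulr_gt0// exprn_gt0// ltr_wpDl.
apply: (sphere_diff_near (F := id) (r := ((n%:R + 1) ^+ 2 * r)^-1)).
- by rewrite invr_gt0.
- move=> x; rewrite subr0 => xr /=; have [->|x0] := eqVneq x 0; first by [].
  have x00 : 0 < `|x| by rewrite normr_gt0.
  rewrite /= hr.
    by have := inversionK (Some x : S); rewrite [inversion (Some x)]/= (negbTE x0).
  have /andP[e1 e2] := inversion_norm x0.
  have e0 : 0 < enorm x ^+ 2 by rewrite (lt_le_trans _ e1)// exprn_gt0.
  rewrite normrZ gtr0_norm ?invr_gt0// mulrC ler_pdivlMr//.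
  apply: (@le_trans _ _ (r * ((n%:R + 1) ^+ 2 * `|x| ^+ 2))).
    rewrite ler_wpM2l ?(ltW r0)// (le_trans e2)// exprMn ler_wpM2r ?sqr_ge0//.
    by rewrite ler_pXn2r ?nnegrE ?addr_ge0// lerDl.
  have xr1 : (n%:R + 1) ^+ 2 * r * `|x| <= 1.
    by rewrite mulrC -ler_pdivlMr// mul1r ltW.
  have -> : r * ((n%:R + 1) ^+ 2 * `|x| ^+ 2) = (n%:R + 1) ^+ 2 * r * `|x| * `|x| by ring.
  by rewrite ler_piMl.
- by split; [exists 1|exact: sdiff_id].
Qed.

End charts.

Section diffeomorphisms_of_the_sphere.
Context {R : realType} {n : nat}.
Local Notation V := 'rV[R]_n.
Local Notation S := (sphere R n).
Local Notation J := (@inversion R n).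

(* In the chart [J] such a diffeomorphism is a compactly supported one of R^n. *)
Lemma isotopic_to_id_near0 (F G : S -> S) (d : R) : (0 < n)%N -> 0 < d ->
  cancel F G -> cancel G F -> (forall p, diffeo_at F p) ->
  (forall x : V, `|x| < d -> F (Some x) = Some x) -> isotopic_to_id G.
Proof.
move=> n0 d0 FK GK dF F1.
have F0 : F (Some 0) = Some 0 by apply: F1; rewrite normr0.
have G0 : G (Some 0) = Some 0 by rewrite -[in LHS]F0 FK.
(* A bijection fixing 0 has a conjugate fixing infinity, so finite points stay finite and the
   conjugate is an extension. *)
have ext (H H' : S -> S) : cancel H H' -> H (Some 0) = Some 0 ->
    extend (affine_part (J \o H \o J)) =1 J \o H \o J.
  move=> HK H0 [x|]; last by rewrite /= H0 /= eqxx.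
  rewrite /= -Some_affine_part// => Hx.
  have /(can_inj inversionK)/(can_inj HK)/(can_inj inversionK) // :
    (J \o H \o J) (Some x) = (J \o H \o J) None.
  by rewrite Hx /= H0 /= eqxx.
pose q := affine_part (J \o F \o J); pose q' := affine_part (J \o G \o J).
have qE := ext _ _ FK F0; have q'E := ext _ _ GK G0.
have qK : cancel q q'.
  move=> x; have : extend q' (extend q (Some x)) = Some x.
    by rewrite q'E qE -[LHS]/(J (G (J (J (F (J (Some x))))))) inversionK FK inversionK.
  by move=> /= [].
have q'K : cancel q' q.
  move=> x; have : extend q (extend q' (Some x)) = Some x.
    by rewrite q'E qE -[LHS]/(J (F (J (J (G (J (Some x))))))) inversionK GK inversionK.
  by move=> /= [].
have qd : compact_diffeo q.
  split; first by exists q'.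
    (* |x| > 1 / d puts the inversion of [x] in the ball where [F] is the identity. *)
    exists (d^-1 + 1) => [|x xd]; first by rewrite addr_gt0// invr_gt0.
    have x00 : 0 < `|x| by rewrite (lt_le_trans _ xd)// addr_gt0// invr_gt0.
    have x0 : x != 0 by rewrite -normr_gt0.
    have : extend q (Some x) = Some x.
      have Jx : J (Some x) = Some ((enorm x ^+ 2)^-1 *: x) by rewrite /= (negbTE x0).
      rewrite qE -[LHS]/(J (F (J (Some x)))) Jx F1; first by rewrite -Jx inversionK.
      have /andP[e1 _] := inversion_norm x0.
      have e0 : 0 < enorm x ^+ 2 by rewrite (lt_le_trans _ e1)// exprn_gt0.
      rewrite normrZ gtr0_norm ?invr_gt0// mulrC ltr_pdivrMr//.
      rewrite (lt_le_trans _ (ler_wpM2l (ltW d0) e1))// expr2 mulrA ltr_pMl//.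
      by rewrite -ltr_pdivrMl// mulr1 (lt_le_trans _ xd)// ltrDl.
    by move=> /= [].
  move=> u; have [M uM [_ dM]] : exists2 M, M \in unitmx & sphere_diff (J \o F \o J) u M.
    apply: (diffeo_at_charts (dF (J (Some u))) (a := true) (b := true) (v := q u)).
      exact: inversionK.
    by have := qE (Some u).
  by exists M.
(* The second half of [euclidean_isotopic] undoes the conjugation. *)
have [_] := compact_diffeo_isotopic n0 (compact_diffeo_inverse qK q'K qd).
apply: isotopic_to_id_eq => p /=; rewrite q'E /= !inversionK//.
Qed.

Lemma C1_diffeo_isotopic (f : S -> S) : (0 < n)%N -> C1_diffeo f ->
  diffeo_orientation_preserving f -> isotopic_to_id f.
Proof.
move=> n0 [g [fK gK cf cg]] fo.
(* Two distinct points cannot both be sent to infinity. *)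
have [v fv] : exists v, f (Some v) <> None.
  case f0 : (f (Some 0)) => [w|]; first by exists 0; rewrite f0.
  exists (const_mx 1) => f1; have := etrans f1 (esym f0).
  move=> /(can_inj fK) [] /matrixP/(_ 0 (Ordinal n0)); rewrite !mxE.
  by move/eqP; rewrite oner_eq0.
pose w := affine_part f v.
pose F z := affine_part f (z + v) - w.
have dF u : f (Some (u + v)) <> None -> sdiff F u (jacobian (affine_part f) (u + v)).
  move=> fu; have [_ dfu] := C1_map_sphere_diff (a := false) (b := false) cf fu.
  have := sdiffD (sdiff_comp (sdiffD (sdiff_id u) (sdiff_cst v u)) dfu) (sdiff_cst (- w) u).
  by rewrite !addr0 mul1mx; apply: sdiff_near ltr01 _.
have [d d0 fd] := C1_map_finite (a := false) (b := false) cf fv.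
have {}fd u : `|u| < d -> f (Some (u + v)) <> None.
  by move=> ud; apply: fd; rewrite addrK.
have F0 : F 0 = 0 by rewrite /F add0r subrr.
have [s sd [c c0 sF]] : exists2 s, compact_diffeo s &
    exists2 c : R, 0 < c & forall x, `|x| < c -> s x = F x.
  apply: (compact_extension (M := jacobian (affine_part f) v) d0 F0).
  - by move=> u /fd/dF; eexists; eassumption.
  - by have := dF 0; rewrite add0r; apply.
  - exact: fo.
have [T Td [cT cT0 TE]] := compact_translation v.
have [W Wd [cW cW0 WE]] := compact_translation w.
have [[s' sK s'K] [r r0 sr] ds] := sd; have [[T' TK T'K] _ _] := Td; have [[W' WK W'K] _ _] := Wd.
have extK (h h' : V -> V) : cancel h h' -> cancel (extend h) (extend h').
  by move=> hK [x|] //=; rewrite hK.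
(* [P] is the inverse of [Q], and f = W Q s T'. Near 0, [f] carries s' x + v to x + w = W x, so [P]
   is the identity there. *)
pose P := extend s \o (extend T' \o (g \o extend W)).
pose Q := extend W' \o (f \o (extend T \o extend s')).
have PK : cancel P Q.
  by move=> p; rewrite /P /Q /= (extK _ _ sK) (extK _ _ T'K) gK (extK _ _ WK).
have QK : cancel Q P.
  by move=> p; rewrite /P /Q /= (extK _ _ W'K) fK (extK _ _ TK) (extK _ _ s'K).
have T'd := compact_diffeo_inverse TK T'K Td.
have dP p : diffeo_at P p.
  apply: diffeo_at_comp; last exact: compact_diffeo_at.
  apply: diffeo_at_comp; last exact: compact_diffeo_at.
  apply: diffeo_at_comp; first exact: compact_diffeo_at.
  exact: C1_diffeo_at gK fK cg cf.
have [L L0 sL] := compact_support_expanding r0 (can_inj sK) sr ds.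
have s0 : s' 0 = 0 by rewrite -[in LHS]F0 -sF ?normr0// sK.
pose m := Num.min (Num.min d c) cT.
have m0 : 0 < m by rewrite !lt_min d0 c0.
have P1 (x : V) : `|x| < Num.min cW (m / L) -> P (Some x) = Some x.
  rewrite lt_min ltr_pdivlMr// => /andP[xW xm].
  have : `|s' x| < m.
    have := sL (s' x) (s' 0); rewrite !s'K s0 !subr0 => h.
    by rewrite (le_lt_trans h)// mulrC.
  rewrite !lt_min => /andP[/andP[zd zc] zT].
  have fz : f (Some (s' x + v)) = Some (x + w).
    rewrite (Some_affine_part (fd _ zd)); congr Some.
    by have xE := sF _ zc; rewrite s'K in xE; rewrite [X in X + w]xE subrK.
  by rewrite /P /= WE// -fz fK /= -TE// TK s'K.
have mW : 0 < Num.min cW (m / L) by rewrite lt_min cW0 divr_gt0.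
have Qi := isotopic_to_id_near0 n0 mW PK QK dP P1.
have [Wi _] := compact_diffeo_isotopic n0 Wd.
have [si _] := compact_diffeo_isotopic n0 sd.
have [T'i _] := compact_diffeo_isotopic n0 T'd.
have := isotopic_to_id_comp (isotopic_to_id_comp T'i si) (isotopic_to_id_comp Qi Wi).
apply: isotopic_to_id_eq => p.
by rewrite /Q /= (extK _ _ sK) (extK _ _ T'K) (extK _ _ W'K).
Qed.

Lemma isotopic_to_id_id : (0 < n)%N -> isotopic_to_id (@id S).
Proof.
move=> n0; have idd : compact_diffeo (@id V).
  split; [by exists id|by exists 1|move=> u; exists 1%:M].
    exact: unitmx1.
  exact: sdiff_id.
have [H _] := compact_diffeo_isotopic n0 idd.
by apply: isotopic_to_id_eq H; case.
Qed.

End diffeomorphisms_of_the_sphere.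

Theorem theorem1p2 (R : realType) (n : nat) (hn : (0 < n)%N)
    (f : sphere R n -> sphere R n)
    (hf : C1_diffeo f) (hf_or : diffeo_orientation_preserving f) :
  exists A p1 p2 : R -> LIP (sphere R n),
    [/\ sphere_bilipschitz_path A,
        sphere_bilipschitz_path p1 &
        sphere_bilipschitz_path p2] /\
    [/\ A 0 =1 id, p1 0 =1 id & p2 0 =1 id] /\
    A 1 \o p2 1 \o p1 1 =1 f.
Proof.
have [A [pA A0 A1]] := isotopic_to_id_path hn (C1_diffeo_isotopic hn hf hf_or).
have [p [pp p0 p1]] := isotopic_to_id_path hn (isotopic_to_id_id (R := R) hn).
exists A, p, p; do 2!split => //.
by move=> x /=; rewrite !p1 A1.
Qed.
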